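(* Consider the model $\mathbf{y}_j=\boldsymbol\mu_j+\boldsymbol\epsilon_j$, $j=1,\dots,m$, described in the context, where $\mathcal{J}_0^c\neq\emptyset$ (not pure noise). Assume that $\boldsymbol\mu_j\in\Theta_j[\eta_{jn}]$ for all $j\in\mathcal{J}_0^c$, where each $\Theta_j[\eta_{jn}]$ is one of $l_0[\eta_{jn}]$ (in which case $p_j=0$), the strong ball $l_{p_j}[\eta_{jn}]$ or the weak ball $m_{p_j}[\eta_{jn}]$ with $p_j>0$ (the types and the parameters $p_j$ are not necessarily the same for all $j$), and where $\eta_{jn}\ge n^{-1/\min(p_j,2)}\sqrt{\ln n}$ for all $p_j>0$ (excluding, thus, super-sparse cases). Let $\hat{\boldsymbol\mu}_1,\dots,\hat{\boldsymbol\mu}_m$ be the sparse group MAP estimators with the complexity penalties $Pen_j$ and $Pen_0$ defined in the context, and assume that there exist constants $c_0,c_1>0$ and $c_2>c(\gamma)$, where $c(\gamma)=8(\gamma+3/4)^2$, such that 1. $\pi_0(k)\ge(k/m)^{c_0k}$, $k=1,\dots,\lfloor m/e\rfloor$, and $\pi_0(m)\ge e^{-c_0m}$; 2. for all $j=1,\dots,m$, $\pi_j(\cdot)$ satisfies Assumption (P), that is, $\pi_j(h)\le\binom{n}{h}e^{-c(\gamma)h}$, $h=1,\dots,n$, and, in addition, $\pi_j(h)\ge(h/n)^{c_1h}$, $h=1,\dots,\lfloor ne^{-c(\gamma)}\rfloor$, and $\pi_j(n)\ge e^{-c_2n}$. Then, for any $\mathcal{J}_0^c\subseteq\{1,\dots,m\}$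 with $|\mathcal{J}_0^c|=m_0$ and all $\Theta_j[\eta_{jn}]$, $j\in\mathcal{J}_0^c$, $$ \sup_{\boldsymbol\mu_j\in\Theta_j[\eta_{jn}],\,j\in\mathcal{J}_0^c}\ \sum_{j=1}^mE\|\hat{\boldsymbol\mu}_j-\boldsymbol\mu_j\|_2^2\le C_1(\gamma)\max\left(\sum_{j\in\mathcal{J}_0^c}R(\Theta_j[\eta_{jn}]),\ \sigma_n^2m_0\ln(m/m_0)\right) $$ for some constant $C_1(\gamma)$ depending only on $\gamma$, where the corresponding $R(\Theta_j[\eta_{jn}])$ are given, up to multiplying constants, by the rates listed in the context.
   Context: Model: one observes independent vectors $\mathbf{y}_j=\boldsymbol\mu_j+\boldsymbol\epsilon_j\in\mathbb{R}^n$, $j=1,\dots,m$, where $\boldsymbol\epsilon_j$ are i.i.d. $\mathcal{N}_n(\mathbf 0,\sigma_n^2I_n)$, the variance $\sigma_n^2>0$ is known and may depend on $n$, and the mean vectors $\boldsymbol\mu_j$ are unknown. $\mathcal{J}_0^c$ is the (unknown) set of indices of the nonzero $\boldsymbol\mu_j$ and $m_0=|\mathcal{J}_0^c|$; thus $\boldsymbol\mu_j=\mathbf 0$ for $j\notin\mathcal{J}_0^c$. The bound is an asymptotic upper bound, as both $m$ and $n$ increase. Priors: $\gamma>0$ is a fixed parameter (ratio of the prior variance of the nonzero components to $\sigma_n^2$). $\pi_0$ is a probability distribution on $\{0,1,\dots,m\}$ with all $\pi_0(k)>0$ (it may depend on $m$); for each $j=1,\dots,m$, $\pi_j$ is a probability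 distribution on $\{1,\dots,n\}$ with all $\pi_j(h)>0$ (it may depend on $n$). Complexity penalties: $$Pen_j(0)=0,\qquad Pen_j(h)=2\sigma_n^2(1+1/\gamma)\ln\left(\pi_j^{-1}(h)\binom{n}{h}(1+\gamma)^{h/2}\right),\quad h=1,\dots,n,$$ $$Pen_0(k)=2\sigma_n^2(1+1/\gamma)\ln\left(\pi_0^{-1}(k)\binom{m}{k}\right),\quad k=0,\dots,m,$$ where $\pi^{-1}(\cdot)$ means $1/\pi(\cdot)$. Sparse group MAP estimators: $(\hat{\boldsymbol\mu}_1,\dots,\hat{\boldsymbol\mu}_m)$ is a minimizer over $\tilde{\boldsymbol\mu}_1,\dots,\tilde{\boldsymbol\mu}_m\in\mathbb{R}^n$ of $$\sum_{j=1}^m\left\{\|\mathbf{y}_j-\tilde{\boldsymbol\mu}_j\|_2^2+Pen_j(\|\tilde{\boldsymbol\mu}_j\|_0)\right\}+Pen_0(k),\qquad k=\#\{j:\tilde{\boldsymbol\mu}_j\ne\mathbf 0\},$$ where $\|\cdot\|_0$ is the number of nonzero components. Balls of standardized radius $\eta$ in $\mathbb{R}^n$: $l_0[\eta]=\{\boldsymbol\mu:\|\boldsymbol\mu\|_0\le\eta n\}$; for $p>0$, the strong ball $l_p[\eta]=\{\boldsymbol\mu:\frac1n\sum_{i=1}^n|\mu_i|^p\le\sigma_n^p\eta^p\}$ and the weak ball $m_p[\eta]=\{\boldsymbol\mu:|\mu|_{(i)}\le\sigma_n\eta(n/i)^{1/p},\ i=1,\dots,n\}$, where $|\mu|_{(1)}\ge\dots\ge|\mu|_{(n)}$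 are the ordered absolute values of the components. For $p=0$, obviously, $\eta\ge n^{-1}$, since the vectors $\boldsymbol\mu_j$, $j\in\mathcal{J}_0^c$, are nonzero. Single-vector minimax risk: $R(\Theta[\eta_n])=\inf_{\tilde{\boldsymbol\mu}}\sup_{\boldsymbol\mu\in\Theta[\eta_n]}E\|\tilde{\boldsymbol\mu}-\boldsymbol\mu\|_2^2$, the infimum being over all estimates $\tilde{\boldsymbol\mu}$ of a single mean vector $\boldsymbol\mu$ in the model with $m=1$. For $p>0$ put $\eta_{0n}=n^{-1/\min(p,2)}\sqrt{\ln n}$. The cases are: dense, $\eta_n\not\to0$; sparse, $\eta_n\to0$ but $\eta_n/\eta_{0n}\not\to0$ for $p>0$ (and $\eta_n\ge n^{-1}$ for $p=0$); super-sparse (for $p>0$), $\eta_n/\eta_{0n}\to0$. The minimax rates (up to multiplying constants) are: dense case, $\sigma_n^2n$ for all $p\ge0$; sparse case, $\sigma_n^2n\eta_n\ln\eta_n^{-1}$ for $p=0$, $\sigma_n^2n\eta_n^p(\ln\eta_n^{-p})^{1-p/2}$ for $0<p<2$, and $\sigma_n^2n\eta_n^2$ for $p\ge2$. The rates are the same for $l_p[\eta_n]$ and $m_p[\eta_n]$, except for $p=2$, where an additional log-term appears for $m_p[\eta_n]$.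
   Formalization: The constant C_1 may depend on c_0, c_1, c_2 as well as γ (all fixed before m, n); a constant depending only on γ is impossible, since a prior π_0(k)=(k/m)^{c_0 k} makes the MAP estimator lose order c_0 σ_n² ln m when m_0=1. *)

(* Defs.v *)
From HB Require Import structures.
From mathcomp Require Import all_boot all_order all_algebra.
From mathcomp Require Import all_classical all_reals all_analysis.
Set Implicit Arguments.
Unset Strict Implicit.
Unset Printing Implicit Defensive.
Import Order.TTheory GRing.Theory Num.Theory.
Local Open Scope classical_set_scope.
Local Open Scope ring_scope.

Section iid_law.
Context d (T : measurableType d) (R : realType).

Definition cons_pair n (x : T * n.-tuple T) : n.+1.-tuple T :=
  [tuple of x.1 :: x.2].

Let measurable_cons_pair n : measurable_fun setT (@cons_pair n).
Proof. exact: measurable_cons. Qed.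

HB.instance Definition _ n := @isMeasurableFun.Build _ _ _ _ (@cons_pair n)
  (@measurable_cons_pair n).

(* Law of [n] independent draws from [P]: the product measure on [n]-tuples. *)
Fixpoint iid_law (P : probability T R) n : probability (n.-tuple T) R :=
  if n is n'.+1 return probability (n.-tuple T) R
  then distribution (P \x iid_law P n')%E (@cons_pair n')
  else dirac ([tuple] : 0.-tuple T).

Lemma iid_lawE (P : probability T R) n (B : 'I_n -> set T) :
  (forall i, measurable (B i)) ->
  iid_law P n [set x | forall i, B i (tnth x i)] = (\prod_(i < n) P (B i))%E.
Proof.
elim: n B => [|n IHn] B mB.
  rewrite big_ord0 /= diracE mem_set//= => -[].
  by [].
have mS k (C : 'I_k -> set T) : (forall i, measurable (C i)) ->
    measurable [set x : k.-tuple T | forall i, C i (tnth x i)].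
  move=> mC.
  rewrite [X in measurable X](_ : _ =
      \bigcap_(i in [set: 'I_k]) (fun x => tnth x i) @^-1` C i); last first.
    by apply/seteqP; split=> [x h i _|x h i]; [exact: h|exact: (h i I)].
  apply: fin_bigcap_measurable => // i _.
  by rewrite -[X in measurable X]setTI; exact: measurable_tnth.
rewrite big_ord_recl -IHn; last by move=> i; exact: mB.
rewrite [LHS]/= /distribution /pushforward.
rewrite [X in (_ \x _)%E X](_ : _ =
    B ord0 `*` [set x : n.-tuple T | forall i, B (lift ord0 i) (tnth x i)]).
  by rewrite product_measure1E//; exact: (mS _ (fun i => B (lift ord0 i))).
apply/seteqP; split=> [[x t] /= h|[x t] /= [h0 h] i].
  split; first by have := h ord0; rewrite tnth0.
  by move=> i; have := h (lift ord0 i); rewrite tnthS.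
have [->|] := eqVneq i ord0; first by rewrite tnth0.
by case: (unliftP ord0 i) => [j ->|->]; rewrite ?eqxx// tnthS.
Qed.

End iid_law.

(* Vectors of R^n, as tuples over the Borel reals: tuples carry the product
   sigma-algebra. *)
Notation vec R n := (n.-tuple (measurableTypeR R)).

Section sparse_groups.
Context {R : realType}.
Implicit Types (m n h k : nat) (sigma gamma eta p : R) (pi : nat -> R).

Definition coord n (x : vec R n) (i : 'I_n) : R := tnth x i.

Definition gauss_noise sigma n : probability (vec R n) R :=
  iid_law (normal_prob 0 sigma) n.

Definition group_noise sigma m n : probability (m.-tuple (vec R n)) R :=
  iid_law (gauss_noise sigma n) m.

Definition vadd n (x y : vec R n) : vec R n :=
  [tuple coord x i + coord y i | i < n].

Definition gadd m n (x y : m.-tuple (vec R n)) : m.-tuple (vec R n) :=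
  [tuple vadd (tnth x j) (tnth y j) | j < m].

Definition vzero n : vec R n := [tuple (0 : R) | i < n].

Definition sqdist n (x y : vec R n) : R :=
  \sum_(i < n) (coord x i - coord y i) ^+ 2.

Definition l0norm n (x : vec R n) : nat :=
  #|[set i : 'I_n | coord x i != 0]%SET|.

Definition abs_decreasing n (x : vec R n) : seq R :=
  sort (fun a b => b <= a) [seq `|coord x i| | i <- enum 'I_n].

Definition l0_ball n eta : set (vec R n) :=
  [set mu | (l0norm mu)%:R <= eta * n%:R].

Definition strong_ball sigma n p eta : set (vec R n) :=
  [set mu | n%:R^-1 * \sum_(i < n) `|coord mu i| `^ p
            <= sigma `^ p * eta `^ p].

(* [nth] counts from 0, whence [i.-1]. *)
Definition weak_ball sigma n p eta : set (vec R n) :=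
  [set mu | forall i, (1 <= i <= n)%N ->
     (abs_decreasing mu)`_i.-1 <= sigma * eta * (n%:R / i%:R) `^ p^-1].

Variant mean_ball : Type :=
  | L0Ball of R            (* radius [eta] *)
  | StrongBall of R & R    (* exponent [p], radius [eta] *)
  | WeakBall of R & R.     (* exponent [p], radius [eta] *)

Definition ball_set sigma n (B : mean_ball) : set (vec R n) :=
  match B with
  | L0Ball eta => @l0_ball n eta
  | StrongBall p eta => @strong_ball sigma n p eta
  | WeakBall p eta => @weak_ball sigma n p eta
  end.

Arguments ball_set sigma n B : clear implicits.

Definition eta_min n p : R :=
  n%:R `^ (- (Num.min p 2)^-1) * Num.sqrt (ln n%:R).

(* The bound for [L0Ball] says that the ball contains a nonzero vector. *)
Definition not_super_sparse n (B : mean_ball) : Prop :=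
  match B with
  | L0Ball eta => n%:R^-1 <= eta
  | StrongBall p eta | WeakBall p eta => 0 < p /\ eta_min n p <= eta
  end.

Definition minimax_risk sigma n (Theta : set (vec R n)) : \bar R :=
  ereal_inf [set ereal_sup
      [set (\int[gauss_noise sigma n]_z
              (sqdist (delta (vadd mu z)) mu)%:E)%E | mu in Theta]
    | delta in [set delta : vec R n -> vec R n |
                measurable_fun setT delta]].

Definition c_gamma gamma : R := 8 * (gamma + 3 / 4) ^+ 2.

Definition pen_within sigma gamma n pi h : R :=
  if h == 0%N then 0 else
  2 * sigma ^+ 2 * (1 + gamma^-1)
    * ln ((pi h)^-1 * 'C(n, h)%:R * (1 + gamma) `^ (h%:R / 2)).

Definition pen_between sigma gamma m pi0 k : R :=
  2 * sigma ^+ 2 * (1 + gamma^-1) * ln ((pi0 k)^-1 * 'C(m, k)%:R).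

Definition positive_prior (a b : nat) pi : Prop :=
  (forall k, (a <= k <= b)%N -> 0 < pi k) /\ \sum_(a <= k < b.+1) pi k = 1.

Section map_estimation.
Variables (sigma gamma : R) (m n : nat).
Variables (pi0 : nat -> R) (pi : 'I_m -> nat -> R).

Definition map_objective (y mu : m.-tuple (vec R n)) : R :=
  \sum_(j < m) (sqdist (tnth y j) (tnth mu j)
                + pen_within sigma gamma n (pi j) (l0norm (tnth mu j)))
  + pen_between sigma gamma m pi0
      #|[set j : 'I_m | tnth mu j != vzero n]%SET|.

(* Minimality is only required almost surely, whatever the true means: on the
   null set of data with some zero coordinate, non-monotone penalties may leave
   the infimum of the objective unattained. *)
Definition map_estimator
    (muhat : m.-tuple (vec R n) -> m.-tuple (vec R n)) : Prop :=
  measurable_fun setT muhat /\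
  forall mu : m.-tuple (vec R n),
    {ae group_noise sigma m n, forall e, forall nu : m.-tuple (vec R n),
       map_objective (gadd mu e) (muhat (gadd mu e))
       <= map_objective (gadd mu e) nu}.

End map_estimation.

Definition group_risk sigma m n
    (muhat : m.-tuple (vec R n) -> m.-tuple (vec R n))
    (mu : m.-tuple (vec R n)) : \bar R :=
  (\sum_(j < m) \int[group_noise sigma m n]_e
     (sqdist (tnth (muhat (gadd mu e)) j) (tnth mu j))%:E)%E.

Definition between_prior_cond (c0 : R) m (pi0 : nat -> R) : Prop :=
  (forall k, (1 <= k <= Num.truncn (m%:R / expR 1 : R))%N ->
     (k%:R / m%:R) `^ (c0 * k%:R) <= pi0 k) /\
  expR (- (c0 * m%:R)) <= pi0 m.

Definition assumption_P gamma n pi : Prop :=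
  forall h, (1 <= h <= n)%N ->
    pi h <= 'C(n, h)%:R * expR (- (c_gamma gamma * h%:R)).

Definition within_prior_cond gamma (c1 c2 : R) n pi : Prop :=
  [/\ assumption_P gamma n pi,
      forall h, (1 <= h <= Num.truncn (n%:R * expR (- c_gamma gamma)))%N ->
        (h%:R / n%:R) `^ (c1 * h%:R) <= pi h
    & expR (- (c2 * n%:R)) <= pi n].

(* The means indexed by [J] range over their whole balls, 0 included. *)
Definition group_parameters sigma m n (J : {set 'I_m})
    (Theta : 'I_m -> mean_ball) : set (m.-tuple (vec R n)) :=
  [set mu | forall j, if j \in J then ball_set sigma n (Theta j) (tnth mu j)
                      else tnth mu j = vzero n].

End sparse_groups.

Arguments mean_ball R : clear implicits.
Arguments ball_set {R} sigma n B.

(* Main.v *)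
From HB Require Import structures.
Require Import Defs.
From mathcomp Require Import all_boot all_order all_algebra.
From mathcomp Require Import all_classical all_reals all_analysis.
From mathcomp Require Import measurable_realfun.
From mathcomp Require Import ring lra zify.
Set Implicit Arguments.
Unset Strict Implicit.
Unset Printing Implicit Defensive.
Import Order.TTheory GRing.Theory Num.Theory.
Local Open Scope classical_set_scope.
Local Open Scope ring_scope.

Local Notation coord := Defs.coord.

(** The risk of the estimator is bounded above by an oracle inequality, the
    minimax risks are bounded below by Bayes risks, and the two meet in one
    quantity, the capped energy of a mean vector,
      G(mu) = sum_k min(mu_(k)^2, sigma^2 (1 + ln(n/k))),
    where |mu_(1)| >= |mu_(2)| >= ... are its ordered absolute values.  No rate
    is computed: every mu of a ball satisfies R(ball) >= const G(mu), while the
    risk at mu is at most const G(mu) plus terms of order sigma^2 ln n per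
    group.  This keeps the constants uniform over the exponents p and over the
    strong and weak balls, including weak balls with p near 2.

    Oracle inequality ([oracle_inequality]).  A model is the choice of a support
    in every group.  The priors make the models into a probability space with
    weights w ([sum_model_weight]), and the penalty of a vector with support S
    is 2 sigma^2 (1 + 1/gamma) (- ln w(S) + |S|/2 ln(1 + gamma)).  Minimality
    against a fixed competitor nu leaves the cross term 2 <e, muhat - mu>.
    Coordinate by coordinate it is at most theta |muhat - mu|^2 plus a variable
    V_S whose exponential moment is at most (1 + 2 gamma)^(|S|/2).  Hence the
    mixture over S of w(S) exp(V_S - |S|/2 ln(1 + 2 gamma)), suitably scaled,
    has expectation at most 1, and it dominates the term of the support selected
    by the data.  So, up to a random variable of expectation at most 1, V_S is a
    multiple of - ln w(S) + |S|/2 ln(1 + 2 gamma), and the penalty absorbs this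
    because Assumption (P) bounds - ln w(S) below by c(gamma) |S|
    ([penalty_slack]).

    Lower bound ([minimax_lower]).  Cut the coordinates into disjoint blocks,
    the k-th one with about sqrt(n/k) elements, and put in block k, with
    probability one half, a spike of height at most |mu_(k)| at a uniform place.
    All these vectors are dominated by mu, hence lie in the ball.  For a
    coordinate x of a block of b elements, the absence of a spike is tested
    against a spike at x; absence is b times as likely, so this test costs
    const t^2 / b as long as the height t satisfies t^2 <= sigma^2 (1 + ln b)
    ([two_point_test]), and the b coordinates of the block add up to const t^2.
    Since ln sqrt(n/k) is half of ln(n/k), nothing is lost by the blocks being
    small, and their sizes add up to n.

    Comparison.  Truncating mu at the largest k for which
    mu_(k)^2 >= sigma^2 (1 + ln(n/k)) gives a competitor whose error plus
    penalty is at most const (G(mu) + sigma^2 ln n) ([competitor_exists]).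
    Balls that are not super-sparse contain a spike of height sigma sqrt(ln n)
    or a constant vector of comparable energy, so R >= const sigma^2 ln n
    ([ball_base_risk]).  This pays for keeping every group of J nonzero, so that
    the number of active groups is exactly m_0, and for the remaining constants.
    If m_0 <= m/e the penalty Pen_0(m_0) is of order sigma^2 m_0 ln(m/m_0);
    otherwise the prior is only controlled at m, and all m groups are made
    nonzero at the expense of a factor e ([group_risk_bound]). *)

(** * Densities and Gaussian integrals *)

Section Density.
Context d (T : measurableType d) (R : realType).
Variables (mu nu : {measure set T -> \bar R}) (h : T -> R).
Hypotheses (mh : measurable_fun setT h) (h_ge0 : forall x, 0 <= h x).
Hypothesis nuE : forall A, measurable A -> nu A = (\int[mu]_(x in A) (h x)%:E)%E.

Import HBNNSimple.

Lemma integral_density_nnsfun (f : {nnsfun T >-> R}) :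
  (\int[nu]_x (f x)%:E = \int[mu]_x ((f x)%:E * (h x)%:E))%E.
Proof.
under [LHS]eq_integral do rewrite fimfunE -fsumEFin//.
rewrite [LHS]ge0_integral_fsum//; last 2 first.
  - by move=> r; exact/measurable_EFinP/measurableT_comp.
  - by move=> n x _; rewrite EFinM nnfun_muleindic_ge0.
under [RHS]eq_integral.
  move=> x xD; rewrite fimfunE -fsumEFin// ge0_mule_fsuml; last first.
    by move=> r; rewrite EFinM nnfun_muleindic_ge0.
  over.
rewrite [RHS]ge0_integral_fsum//; last 2 first.
  - move=> r; apply: emeasurable_funM; last exact/measurable_EFinP.
    by apply/measurable_EFinP; do 2 apply/measurableT_comp => //.
  - move=> n x _; apply: mule_ge0; last by rewrite lee_fin.
    by rewrite EFinM nnfun_muleindic_ge0.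
apply: eq_fsbigr => r _.
rewrite integralZl_indic_nnsfun//= integral_indic// setIT nuE//.
rewrite integral_mkcond.
have [r0|r0] := ltP r 0.
  rewrite preimage_nnfun0//.
  rewrite [X in (_ * X)%E](_ : _ = 0%E) ?mule0; last first.
    by under eq_integral do rewrite patchE in_set0; rewrite integral0.
  by under eq_integral do rewrite indic0 mulr0 mul0e; rewrite integral0.
rewrite -ge0_integralZl//.
- apply: eq_integral => x _; rewrite patchE indicE.
  by case: ifP => _; rewrite ?mulr1 ?mulr0 ?mule0 ?mul0e.
- apply/(measurable_restrictT _ _).1 => //.
  by apply/measurable_funTS/measurable_EFinP.
- by move=> x _; rewrite patchE; case: ifP; rewrite ?lee_fin.
Qed.

(** The hypothesis on [nu] is only about sets, which is how [normal_prob] is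
    defined; the formula extends from indicators by monotone convergence. *)
Lemma ge0_integral_density (f : T -> \bar R) :
  measurable_fun setT f -> (forall x, 0 <= f x)%E ->
  (\int[nu]_x f x = \int[mu]_x (f x * (h x)%:E))%E.
Proof.
move=> mf f0.
pose f_ := nnsfun_approx measurableT mf.
transitivity (lim (\int[nu]_x (f_ n x)%:E @[n --> \oo])%E).
  rewrite -monotone_convergence//=.
  - apply: eq_integral => ? /[!inE] xD; apply/esym/cvg_lim => //=.
    exact: cvg_nnsfun_approx.
  - by move=> n; exact/measurable_EFinP/measurable_funTS.
  - by move=> n ? _; rewrite lee_fin.
  - by move=> ? _ ? ? mn; rewrite lee_fin; exact/lefP/nd_nnsfun_approx.
transitivity (lim (\int[mu]_x ((f_ n x)%:E * (h x)%:E)%E @[n --> \oo])%E).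
  rewrite (_ : (fun n => _) =
    fun n => (\int[mu]_x ((f_ n x)%:E * (h x)%:E))%E)//.
  by apply/funext => n; exact: integral_density_nnsfun.
rewrite -monotone_convergence//=.
- apply: eq_integral => x _; apply: cvg_lim => //=.
  by apply: cvgeZr => //; exact: cvg_nnsfun_approx.
- move=> n; apply: emeasurable_funM; exact/measurable_EFinP.
- by move=> n x _; rewrite mule_ge0 ?lee_fin.
- move=> x _ a b ab; rewrite lee_pmul ?lee_fin//.
  exact/lefP/nd_nnsfun_approx.
Qed.
End Density.

Lemma measurable_fun_EFin d (T : measurableType d) (R : realType) (f : T -> R) :
  measurable_fun setT f -> measurable_fun setT (fun x => (f x)%:E).
Proof. by move=> mf; exact/measurable_EFinP. Qed.

Lemma measurable_expR_comp d (T : measurableType d) (R : realType) (f : T -> R) :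
  measurable_fun setT f -> measurable_fun setT (fun x => expR (f x)).
Proof. by move=> mf; exact: measurableT_comp. Qed.

Lemma integral_scale d (T : measurableType d) (R : realType)
    (mu : {measure set T -> \bar R}) (k : R) (f : T -> R) :
  0 <= k -> measurable_fun setT f -> (forall x, 0 <= f x) ->
  (\int[mu]_x (k * f x)%:E = k%:E * \int[mu]_x (f x)%:E)%E.
Proof.
move=> k0 mf f0; under eq_integral do rewrite EFinM.
rewrite (@ge0_integralZl_EFin _ _ _ mu setT)//; last exact: measurable_fun_EFin.
by move=> x _; rewrite lee_fin.
Qed.

Lemma integral_affine_le d (X : measurableType d) (R : realType) (P : probability X R)
    (a b c : R) (D M : X -> R) :
  0 <= a -> 0 <= b -> 0 <= c ->
  measurable_fun setT D -> measurable_fun setT M ->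
  (forall x, 0 <= D x) -> (forall x, 0 <= M x) ->
  (\int[P]_x (D x)%:E <= 1)%E -> (\int[P]_x (M x)%:E <= 1)%E ->
  (\int[P]_x (a + b * D x + c * M x)%:E <= (a + b + c)%:E)%E.
Proof.
move=> a0 b0 c0 mD mM D0 M0 D1 M1.
have mbD : measurable_fun setT (fun x => (b * D x)%:E).
  by apply: measurable_fun_EFin; exact: measurable_funM.
have mcM : measurable_fun setT (fun x => (c * M x)%:E).
  by apply: measurable_fun_EFin; exact: measurable_funM.
under eq_integral do rewrite -addrA 2!EFinD.
rewrite ge0_integralD//; last 2 first.
- by move=> x _; rewrite adde_ge0// lee_fin mulr_ge0.
- exact: emeasurable_funD.
rewrite ge0_integralD//; last 2 first.
- by move=> x _; rewrite lee_fin mulr_ge0.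
- by move=> x _; rewrite lee_fin mulr_ge0.
rewrite [X in (X + _)%E](_ : _ = a%:E); last first.
  rewrite integral_cst//; apply: etrans (mule1 _); congr (_ * _)%E.
  exact: probability_setT.
rewrite -[a + b + c]addrA EFinD; apply: leeD2l; rewrite EFinD; apply: leeD.
- under eq_integral do rewrite EFinM.
  rewrite (@ge0_integralZl_EFin _ _ _ P setT)//; last exact: measurable_fun_EFin.
    by rewrite -[leRHS]mule1 lee_wpmul2l ?lee_fin.
  by move=> x _; rewrite lee_fin.
- under eq_integral do rewrite EFinM.
  rewrite (@ge0_integralZl_EFin _ _ _ P setT)//; last exact: measurable_fun_EFin.
    by rewrite -[leRHS]mule1 lee_wpmul2l ?lee_fin.
  by move=> x _; rewrite lee_fin.
Qed.

Section GaussianIntegrals.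
Variables (R : realType) (s : R).
Hypothesis s_gt0 : 0 < s.
Let s_neq0 : s != 0. Proof. by rewrite gt_eqF. Qed.

Local Notation mu := (@lebesgue_measure R).
Local Notation gauss := (normal_prob 0 s).

Lemma integral_normal (f : measurableTypeR R -> \bar R) :
  measurable_fun setT f -> (forall x, 0 <= f x)%E ->
  (\int[gauss]_x f x = \int[mu]_x (f x * (normal_pdf 0 s x)%:E))%E.
Proof.
apply: ge0_integral_density => //; first exact: measurable_normal_pdf.
by move=> x; exact: normal_pdf_ge0.
Qed.

Lemma measurable_addl (u : R) :
  measurable_fun setT (fun x : measurableTypeR R => u + x : measurableTypeR R).
Proof. exact: measurable_funD. Qed.

Lemma lebesgue_measure_addl (u : R) (A : set (measurableTypeR R)) :
  measurable A -> pushforward mu (fun x => u + x : measurableTypeR R) A = mu A.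
Proof.
move=> mA; apply/esym.
have mf := measurable_addl u.
pose f : {mfun measurableTypeR R >-> measurableTypeR R} :=
  HB.pack (fun x : measurableTypeR R => u + x : measurableTypeR R)
    (isMeasurableFun.Build _ _ _ _ _ mf).
apply: (@lebesgue_measure_unique R (pushforward mu f)) => // _ [[a b]] _ <-.
rewrite /= /pushforward.
have -> : f @^-1` [set` `]a, b]] = [set` `](a - u), (b - u)]].
  by apply/seteqP; split => x /=; rewrite !in_itv/= => /andP[h1 h2]; apply/andP; split; lra.
by rewrite !lebesgue_measure_itv/= !lte_fin ltrD2r -!EFinD opprB addrA subrK.
Qed.

Lemma integral_lebesgue_addl (u : R) (f : measurableTypeR R -> \bar R) :
  measurable_fun setT f -> (forall x, 0 <= f x)%E ->
  (\int[mu]_x f (u + x)%R = \int[mu]_x f x)%E.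
Proof.
move=> mf f0; have ma := measurable_addl u.
pose a : {mfun measurableTypeR R >-> measurableTypeR R} :=
  HB.pack (fun x : measurableTypeR R => u + x : measurableTypeR R)
    (isMeasurableFun.Build _ _ _ _ _ ma).
have := @ge0_integral_pushforward _ _ _ _ R a (measurable_funPT a) mu setT f measurableT mf.
rewrite preimage_setT => <-//.
by apply: eq_measure_integral => A mA _; exact: lebesgue_measure_addl.
Qed.

(** One-dimensional Cameron-Martin formula: after translating Lebesgue measure,
    the quotient of the two Gaussian densities is the exponential factor. *)
Lemma gauss_shift (u : R) (g : measurableTypeR R -> \bar R) :
  measurable_fun setT g -> (forall x, 0 <= g x)%E ->
  (\int[gauss]_x g (u + x)%R =
   \int[gauss]_x (g x * (expR (u * x / s ^+ 2 - u ^+ 2 / (2 * s ^+ 2)))%:E))%E.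
Proof.
move=> mg g0.
have mpdf := measurable_normal_pdf (0 : R) s.
have mexp : measurable_fun setT (fun x : measurableTypeR R =>
    expR (u * x / s ^+ 2 - u ^+ 2 / (2 * s ^+ 2))).
  apply: measurableT_comp => //; apply: measurable_funD => //.
  by apply: measurable_funM => //; exact: measurable_funM.
rewrite integral_normal//; last first.
  by apply: (measurableT_comp mg); exact: measurable_addl.
rewrite integral_normal//; last 2 first.
  by apply: emeasurable_funM => //; exact: measurable_fun_EFin.
  by move=> x; rewrite mule_ge0 ?lee_fin ?expR_ge0.
have h x : (g x * (expR (u * x / s ^+ 2 - u ^+ 2 / (2 * s ^+ 2)))%:E *
    (normal_pdf 0 s x)%:E = g x * (normal_pdf 0 s (x - u))%:E)%E.
  rewrite -muleA -EFinM !normal_pdfE// /normal_fun mulrCA -expRD.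
  congr (_ * (_ * expR _)%:E)%E; rewrite !subr0 -mulr_natl.
  by field.
under [RHS]eq_integral do rewrite h.
have mf : measurable_fun setT
    (fun x : measurableTypeR R => (g x * (normal_pdf 0 s (x - u))%:E)%E).
  apply: emeasurable_funM => //; apply: measurable_fun_EFin.
  by apply: (measurableT_comp mpdf); exact: measurable_funD.
have f0 x : (0 <= g x * (normal_pdf 0 s (x - u))%:E)%E.
  by rewrite mule_ge0 ?lee_fin ?normal_pdf_ge0.
apply: etrans (integral_lebesgue_addl u mf f0).
by apply: eq_integral => x _; rewrite addrAC subrr add0r.
Qed.

Lemma gauss_exp_linear (u : R) :
  (\int[gauss]_x (expR (u * x / s ^+ 2 - u ^+ 2 / (2 * s ^+ 2)))%:E = 1)%E.
Proof.
rewrite -[LHS](_ : (\int[gauss]_x (1 * (expR (u * x / s ^+ 2 - u ^+ 2 / (2 * s ^+ 2)))%:E) = _)%E); last first.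
  by apply: eq_integral => x _; rewrite mul1e.
rewrite -(@gauss_shift u (fun=> 1%E))//.
by rewrite integral_cst// mul1e; exact: probability_setT.
Qed.

(** The integrand turns the density of variance s^2 into sqrt(1 + g) times the
    density of variance s^2 (1 + g).  In this parametrization a coordinate costs
    ln(1 + g) / 2, the form in which it is charged by the penalty. *)
Lemma gauss_exp_square (g : R) : 0 <= g ->
  (\int[gauss]_x (expR (g / (1 + g) / (2 * s ^+ 2) * x ^+ 2))%:E =
   (Num.sqrt (1 + g))%:E)%E.
Proof.
move=> g0; have g1 : 0 < 1 + g by lra.
have sg : 0 < Num.sqrt (1 + g) by rewrite sqrtr_gt0.
have mexp : measurable_fun setT (fun x : measurableTypeR R =>
    (expR (g / (1 + g) / (2 * s ^+ 2) * x ^+ 2))%:E).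
  apply: measurable_fun_EFin; apply: measurableT_comp => //.
  by apply: measurable_funM => //; exact: measurable_funX.
rewrite integral_normal//.
have s' : s * Num.sqrt (1 + g) != 0 by rewrite mulf_neq0// gt_eqF.
have scaled : (\int[mu]_x ((Num.sqrt (1 + g))%:E *
    (normal_pdf 0 (s * Num.sqrt (1 + g)) x)%:E) = (Num.sqrt (1 + g))%:E)%E.
  rewrite (@ge0_integralZl_EFin _ _ _ mu setT) ?ltW//.
  - by rewrite integral_normal_pdf mule1.
  - by move=> x _; rewrite lee_fin normal_pdf_ge0.
  - by apply: measurable_fun_EFin; exact: measurable_normal_pdf.
apply: etrans scaled.
apply: eq_integral => x _; rewrite -!EFinM !normal_pdfE//; congr EFin.
rewrite /normal_peak /normal_fun exprMn sqr_sqrtr ?ltW// !subr0.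
rewrite mulrCA -expRD [RHS]mulrA.
congr (_ * expR _).
  have -> : s ^+ 2 * (1 + g) * pi *+ 2 = (1 + g) * (s ^+ 2 * pi *+ 2).
    by rewrite [_ * (1 + g)]mulrC -mulrA mulrnAr.
  by rewrite sqrtrM ?ltW// invfM mulrA mulfV ?gt_eqF// mul1r.
rewrite -[s ^+ 2 *+ 2]mulr_natl -[_ * (1 + g) *+ 2]mulr_natl; field.
by rewrite s_neq0/= gt_eqF.
Qed.

End GaussianIntegrals.

(** * Integrals against product laws *)

Section IidLaw.
Context d (T : measurableType d) (R : realType) (P : probability T R).

Lemma integral_iid_law_cons n (f : n.+1.-tuple T -> \bar R) :
  measurable_fun setT f -> (forall x, 0 <= f x)%E ->
  (\int[iid_law P n.+1]_z f z =
   \int[P]_x \int[iid_law P n]_t f (cons_pair (x, t)))%E.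
Proof.
move=> mf f0 /=.
rewrite ge0_integral_distribution// fubini_tonelli1//; last by move=> x /=.
by apply: measurableT_comp.
Qed.

Lemma measurable_iid_inner n (f : n.+1.-tuple T -> \bar R) :
  measurable_fun setT f -> (forall x, 0 <= f x)%E ->
  measurable_fun setT (fun x => \int[iid_law P n]_t f (cons_pair (x, t)))%E.
Proof.
move=> mf f0.
apply: (@measurable_fun_fubini_tonelli_F _ _ _ _ R (iid_law P n)
  (f \o (@cons_pair _ T n))) => //; last by move=> x /=.
by apply: measurableT_comp.
Qed.

Lemma measurable_fun_cons_pair n (x : T) :
  measurable_fun setT (fun t : n.-tuple T => cons_pair (x, t)).
Proof. exact: (measurable_cons (measurable_cst x) (@measurable_id _ _ setT)). Qed.

Lemma tnth_cons_pairS n x (t : n.-tuple T) i :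
  tnth (cons_pair (x, t)) (lift ord0 i) = tnth t i.
Proof. exact: tnthS. Qed.

Lemma measurable_prod_tnth n (f : 'I_n -> T -> R) :
  (forall i, measurable_fun setT (f i)) ->
  measurable_fun setT (fun z : n.-tuple T => \prod_i f i (tnth z i)).
Proof.
move=> mf; apply: measurable_prod => i _.
by apply: measurableT_comp => //; exact: measurable_tnth.
Qed.

(** Independence, in the one-sided form needed for exponential moments. *)
Lemma integral_iid_law_prod_le n (f : 'I_n -> T -> R) (c : 'I_n -> R) :
  (forall i, measurable_fun setT (f i)) -> (forall i x, 0 <= f i x) ->
  (forall i, (\int[P]_x (f i x)%:E <= (c i)%:E)%E) ->
  (\int[iid_law P n]_z (\prod_i f i (tnth z i))%:E <= (\prod_i c i)%:E)%E.
Proof.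
elim: n f c => [|n IH] f c mf f0 fc.
  rewrite big_ord0 (eq_integral (fun=> 1%E)); last first.
    by move=> x _; rewrite big_ord0.
  by rewrite integral_cst// mul1e; have /= -> := probability_setT (iid_law P 0).
have c0 i : 0 <= c i.
  by rewrite -lee_fin (le_trans _ (fc i))// integral_ge0// => x _; rewrite lee_fin.
rewrite integral_iid_law_cons//; last 2 first.
- apply: measurable_fun_EFin; exact: measurable_prod_tnth.
- by move=> x; rewrite lee_fin prodr_ge0.
pose g (t : n.-tuple T) := (\prod_i f (lift ord0 i) (tnth t i))%:E.
have mg : measurable_fun setT g.
  by apply: measurable_fun_EFin; apply: (@measurable_prod_tnth _ (fun i => f (lift ord0 i))).
have g0 t : (0 <= g t)%E by rewrite lee_fin prodr_ge0.
have eqf x : (\int[iid_law P n]_t (\prod_i f i (tnth (cons_pair (x, t)) i))%:E =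
              (f ord0 x)%:E * \int[iid_law P n]_t g t)%E.
  rewrite -ge0_integralZl ?lee_fin//.
  apply: eq_integral => t _; rewrite big_ord_recl EFinM; congr (_ * _%:E)%E.
  by apply: eq_bigr => i _; rewrite tnth_cons_pairS.
under eq_integral do rewrite eqf.
rewrite ge0_integralZr ?integral_ge0//; last 2 first.
- exact: measurable_fun_EFin.
- by move=> x _; rewrite lee_fin.
rewrite big_ord_recl EFinM lee_pmul//.
- by apply: integral_ge0 => x _; rewrite lee_fin.
- exact: integral_ge0.
- by apply: (IH (fun i => f (lift ord0 i)) (fun i => c (lift ord0 i))).
Qed.

(** Change of variables tensorizes: if the map [s i] of the [i]-th factor
    amounts to reweighting it by [w i], then applying all of them amounts to
    reweighting by the product.  It is used for Gaussian translations. *)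
Lemma integral_iid_law_map n (s : 'I_n -> T -> T) (w : 'I_n -> T -> R)
    (g : n.-tuple T -> \bar R) :
  (forall i, measurable_fun setT (s i)) ->
  (forall i, measurable_fun setT (w i)) -> (forall i x, 0 <= w i x) ->
  (forall i h, measurable_fun setT h -> (forall x, 0 <= h x)%E ->
     (\int[P]_x h (s i x) = \int[P]_x (h x * (w i x)%:E))%E) ->
  measurable_fun setT g -> (forall z, 0 <= g z)%E ->
  (\int[iid_law P n]_z g [tuple s i (tnth z i) | i < n] =
   \int[iid_law P n]_z (g z * (\prod_i w i (tnth z i))%:E))%E.
Proof.
elim: n s w g => [|n IH] s w g ms mw w0 sw mg g0.
  by apply: eq_integral => z _; rewrite big_ord0 mule1; congr g; apply/eq_from_tnth => -[].
have mS : measurable_fun setT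
    (fun z : n.+1.-tuple T => [tuple s i (tnth z i) | i < n.+1]).
  apply/measurable_fun_tnthP => i.
  rewrite (_ : _ \o _ = s i \o (fun z => tnth z i)); last first.
    by apply/funext => z /=; rewrite tnth_mktuple.
  by apply: measurableT_comp => //; exact: measurable_tnth.
have mW : measurable_fun setT
    (fun z : n.+1.-tuple T => (\prod_i w i (tnth z i))%:E).
  by apply: measurable_fun_EFin; exact: measurable_prod_tnth.
rewrite integral_iid_law_cons//; last exact: (measurableT_comp mg mS).
rewrite integral_iid_law_cons//; last 2 first.
- by apply: emeasurable_funM.
- by move=> z; rewrite mule_ge0// lee_fin prodr_ge0.
pose W (t : n.-tuple T) := (\prod_i w (lift ord0 i) (tnth t i))%:E.
have mW' : measurable_fun setT W.
  by apply: measurable_fun_EFin; apply: (@measurable_prod_tnth _ (fun i => w (lift ord0 i))).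
have W0 t : (0 <= W t)%E by rewrite lee_fin prodr_ge0.
pose h x := (\int[iid_law P n]_t (g (cons_pair (x, t)) * W t))%E.
have eqL x : (\int[iid_law P n]_t
   g [tuple s i (tnth (cons_pair (x, t)) i) | i < n.+1] = h (s ord0 x))%E.
  rewrite /h -(IH (fun i => s (lift ord0 i)) (fun i => w (lift ord0 i))
    (fun t => g (cons_pair (s ord0 x, t))))//.
  - apply: eq_integral => t _; congr g; apply/eq_from_tnth => i.
    rewrite tnth_mktuple; have [->|] := eqVneq i ord0; first by [].
    by case: (unliftP ord0 i) => [j -> _|->]; rewrite ?eqxx// !tnth_cons_pairS tnth_mktuple.
  - by move=> i *; exact: sw.
  - by apply: (measurableT_comp mg); exact: measurable_fun_cons_pair.
under [LHS]eq_integral do rewrite eqL.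
have mgW : measurable_fun setT (fun z : n.+1.-tuple T =>
    (g z * (\prod_i w (lift ord0 i) (tnth z (lift ord0 i)))%:E)%E).
  apply: emeasurable_funM => //; apply: measurable_fun_EFin.
  apply: measurable_prod => i _.
  by apply: measurableT_comp => //; exact: measurable_tnth.
rewrite (sw ord0)//; last 2 first.
- rewrite (_ : h = fun x => (\int[iid_law P n]_t
    ((fun z => (g z * (\prod_i w (lift ord0 i) (tnth z (lift ord0 i)))%:E)%E) (cons_pair (x, t))))%E).
    by apply: (measurable_iid_inner mgW) => z; rewrite mule_ge0// lee_fin prodr_ge0.
  apply/funext => x; apply: eq_integral => t _; congr (_ * _%:E)%E.
  by apply: eq_bigr => i _; rewrite tnth_cons_pairS.
- by move=> x; apply: integral_ge0 => t _; rewrite mule_ge0.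
apply: eq_integral => x _; rewrite /h -ge0_integralZr ?lee_fin//.
- apply: eq_integral => t _; rewrite big_ord_recl -muleA EFinM.
  congr (_ * _)%E; rewrite muleC; congr (_ * _%:E)%E.
  by apply: eq_bigr => i _; rewrite tnth_cons_pairS.
- apply: emeasurable_funM => //.
  by apply: (measurableT_comp mg); exact: measurable_fun_cons_pair.
- by move=> t _; rewrite mule_ge0.
Qed.

End IidLaw.

Section Vectors.
Variable R : realType.

Lemma measurable_coord k d (X : measurableType d) (f : X -> vec R k) i :
  measurable_fun setT f -> measurable_fun setT (fun x => coord (f x) i).
Proof. by move=> mf; apply: (measurableT_comp (measurable_tnth i) mf). Qed.

Lemma measurable_sqdist k d (X : measurableType d) (f : X -> vec R k) (v : vec R k) :
  measurable_fun setT f -> measurable_fun setT (fun x => sqdist (f x) v).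
Proof.
move=> mf; apply: measurable_sum => i; apply: measurable_funX.
by apply: measurable_funB => //; exact: measurable_coord.
Qed.

Lemma measurable_vadd k (v : vec R k) : measurable_fun setT (vadd v).
Proof.
apply/measurable_fun_tnthP => i.
rewrite (_ : _ \o _ = fun x => coord v i + coord x i); last first.
  by apply/funext => x /=; rewrite tnth_mktuple.
by apply: measurable_funD => //; exact: (measurable_coord i (@measurable_id _ _ setT)).
Qed.

Lemma measurable_gadd m n (mu : m.-tuple (vec R n)) : measurable_fun setT (gadd mu).
Proof.
apply/measurable_fun_tnthP => j.
rewrite (_ : _ \o _ = fun e => vadd (tnth mu j) (tnth e j)); last first.
  by apply/funext => x /=; rewrite tnth_mktuple.
by apply: (measurableT_comp (@measurable_vadd _ _)); exact: measurable_tnth.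
Qed.

Lemma sqdist_ge0 k (x y : vec R k) : 0 <= sqdist x y.
Proof. by apply: sumr_ge0 => i _; exact: sqr_ge0. Qed.

End Vectors.

(** * Prior weights of the models *)

Section ModelWeights.
Variable R : realType.

Lemma sum_by_card (N : nat) (f : nat -> R) :
  \sum_(T : {set 'I_N}) f #|T| = \sum_(0 <= h < N.+1) 'C(N, h)%:R * f h.
Proof.
rewrite big_mkord (partition_big (fun T : {set 'I_N} => inord #|T| : 'I_N.+1) xpredT)//=.
apply: eq_bigr => h _.
have inordE (T : {set 'I_N}) : (inord #|T| == h) = (#|T| == h).
  rewrite -val_eqE /= inordK// ltnS.
  by rewrite (leq_trans (max_card _))// card_ord.
transitivity (\sum_(T : {set 'I_N} | #|T| == h) f h).
  by apply: eq_big => // T; rewrite inordE => /eqP ->.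
rewrite sumr_const -[LHS]mulr_natl; congr (_%:R * _).
rewrite -[N in 'C(N, _)]card_ord -card_draws; apply: eq_card => T.
by rewrite !inE.
Qed.

Definition active (m n : nat) (S : {ffun 'I_m -> {set 'I_n}}) : {set 'I_m} :=
  [set j | S j != finset.set0]%SET.

(** The empty support has weight 1: whether a group is active is decided by
    the prior [pi0] on the number of active groups, not by [pi]. *)
Definition support_weight (n : nat) (pi : nat -> R) (T : {set 'I_n}) : R :=
  if T == finset.set0 then 1 else pi #|T| / 'C(n, #|T|)%:R.

(** Prior probability of the model S: draw the number of active groups, then
    the active groups uniformly, then in each of them the size of the support
    and the support uniformly. *)
Definition model_weight (m n : nat) (pi0 : nat -> R) (pi : 'I_m -> nat -> R)
    (S : {ffun 'I_m -> {set 'I_n}}) : R :=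
  pi0 #|active S| / 'C(m, #|active S|)%:R * \prod_j support_weight (pi j) (S j).

Lemma bin_neq0 N h : (h <= N)%N -> 'C(N, h)%:R != 0 :> R.
Proof. by move=> hN; rewrite pnatr_eq0 -lt0n bin_gt0. Qed.

Lemma sum_support_weight n (pi : nat -> R) : positive_prior 1 n pi ->
  \sum_(T : {set 'I_n} | T != finset.set0) support_weight pi T = 1.
Proof.
move=> [_ <-].
transitivity (\sum_(T : {set 'I_n}) (if #|T| == 0%N then 0 else pi #|T| / 'C(n, #|T|)%:R)).
  rewrite big_mkcond/=; apply: eq_bigr => T _.
  by rewrite cards_eq0 /support_weight; case: eqP.
rewrite (sum_by_card n (fun h => if h == 0%N then 0 else pi h / 'C(n, h)%:R)).
rewrite big_ltn//= mulr0 add0r big_nat [RHS]big_nat.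
apply: eq_bigr => h /andP[h0 hn].
by rewrite gtn_eqF// mulrC divfK// bin_neq0.
Qed.

(** This replaces a union bound over the models: exponential moments of all
    models are averaged with these weights. *)
Lemma sum_model_weight m n (pi0 : nat -> R) (pi : 'I_m -> nat -> R) :
  positive_prior 0 m pi0 -> (forall j, positive_prior 1 n (pi j)) ->
  \sum_(S : {ffun 'I_m -> {set 'I_n}}) model_weight pi0 pi S = 1.
Proof.
move=> [_ sum0] prior.
rewrite (partition_big (@active m n) xpredT)//=.
transitivity (\sum_(A : {set 'I_m}) pi0 #|A| / 'C(m, #|A|)%:R); last first.
  rewrite (sum_by_card m (fun k => pi0 k / 'C(m, k)%:R)); apply: etrans sum0.
  rewrite big_nat [RHS]big_nat; apply: eq_bigr => k /andP[_ km].
  by rewrite mulrC divfK// bin_neq0.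
apply: eq_bigr => A _.
transitivity (\sum_(S in family (fun j => [pred T : {set 'I_n} | (T != finset.set0) == (j \in A)]))
   (pi0 #|A| / 'C(m, #|A|)%:R * \prod_j support_weight (pi j) (S j))).
  apply: eq_big => S; last by move=> /eqP <-.
  apply/eqP/familyP => [<- j|h]; first by rewrite inE /active inE.
  by apply/setP => j; have := h j; rewrite /active !inE => /eqP.
rewrite -big_distrr/= -[RHS]mulr1; congr (_ * _).
rewrite -(bigA_distr_big_dep (fun j => [pred T : {set 'I_n} | (T != finset.set0) == (j \in A)])
  (fun j T => support_weight (pi j) T)).
apply: big1 => j _; case: (j \in A).
  rewrite -(sum_support_weight (prior j)); apply: eq_bigl => T.
  by rewrite inE eqb_id.
rewrite (eq_bigl (pred1 finset.set0)); last first.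
  by move=> T; rewrite !inE eqbF_neg negbK.
by rewrite big_pred1_eq /support_weight eqxx.
Qed.

End ModelWeights.

Lemma ln_prod (R : realType) (I : finType) (f : I -> R) :
  (forall i, 0 < f i) -> ln (\prod_i f i) = \sum_i ln (f i).
Proof.
move=> f0; rewrite -[RHS]expRK expR_sum; congr ln.
by apply: eq_bigr => i _; rewrite lnK// posrE.
Qed.

(** * Oracle inequality *)

Section Oracle.
Variables (R : realType) (gamma : R).
Hypothesis gamma_gt0 : 0 < gamma.

(** The fraction theta of the squared error that is given up in order to bound
    the cross term.  Its inverse is a factor that the penalty can afford, as
    computed in [penalty_slack]. *)
Definition split_coef : R :=
  (2 * gamma + 1) * (8 * gamma + 13) / ((2 * gamma + 2) * (8 * gamma + 12)).

(** The scale, relative to sigma^2, at which exponential moments are taken.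
    Divided by [split_coef] it is gamma / (1 + 2 gamma), which
    [gauss_exp_square] with g = 2 gamma requires. *)
Definition moment_coef : R := split_coef * gamma / (1 + 2 * gamma).

Lemma split_coef_gt0 : 0 < split_coef.
Proof. by rewrite divr_gt0// mulr_gt0//; move: gamma_gt0; lra. Qed.

Lemma split_coef_lt1 : split_coef < 1.
Proof.
rewrite ltr_pdivrMr ?mul1r; last by rewrite mulr_gt0//; move: gamma_gt0; lra.
by move: gamma_gt0; nra.
Qed.

Lemma moment_coef_gt0 : 0 < moment_coef.
Proof.
rewrite divr_gt0//; first exact: mulr_gt0 split_coef_gt0 gamma_gt0.
by move: gamma_gt0; lra.
Qed.

Lemma moment_coef_le : 2 * moment_coef <= split_coef.
Proof.
rewrite /moment_coef mulrA ler_pdivrMr; last by move: gamma_gt0; lra.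
by rewrite mulrDr mulr1 mulrCA lerDr ltW// split_coef_gt0.
Qed.

(** The role of c(gamma).  The penalty matches exponential moments taken with
    parameter gamma; taking them with 2 gamma instead replaces the factor
    1 + 1/gamma by 1 + 1/(2 gamma), at the price of at most gamma for each of the
    H coordinates.  As L is at least c(gamma) H, the gain exceeds the price and
    leaves the factor [split_coef] < 1. *)
Lemma penalty_slack (L H : R) : 0 <= H -> c_gamma gamma * H <= L ->
  (L + H / 2 * ln (1 + 2 * gamma)) / moment_coef
  <= 2 * (1 + gamma^-1) * (L + H / 2 * ln (1 + gamma)).
Proof.
move=> H0; rewrite /c_gamma => cHL; have g0 := gamma_gt0.
have ln2 : ln (1 + 2 * gamma) <= 2 * gamma by apply: le_ln1Dx; lra.
have ln1 : 0 <= ln (1 + gamma) by apply: ln_ge0; lra.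
have lnH : H / 2 * ln (1 + 2 * gamma) <= H * gamma.
  by rewrite (_ : H * gamma = H / 2 * (2 * gamma)) ?ler_wpM2l ?divr_ge0//; field.
have L0 : 0 <= L by apply: le_trans cHL; rewrite mulr_ge0// mulr_ge0// sqr_ge0.
rewrite ler_pdivrMr ?moment_coef_gt0//.
apply: (le_trans (y := L + H * gamma)); first by rewrite lerD2l.
apply: (le_trans (y := 2 * (1 + gamma^-1) * L * moment_coef)); last first.
  rewrite ler_wpM2r ?(ltW moment_coef_gt0)// ler_wpM2l//.
    by rewrite mulr_ge0// addr_ge0// invr_ge0 ltW.
  by rewrite lerDl mulr_ge0// divr_ge0.
have -> : 2 * (1 + gamma^-1) * L * moment_coef = L * (8 * gamma + 13) / (8 * gamma + 12).
  rewrite /moment_coef /split_coef; field.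
  by rewrite !gt_eqF//; lra.
rewrite ler_pdivlMr; last by lra.
have : 0 <= H * gamma by rewrite mulr_ge0// ltW.
have : 0 <= H * gamma ^+ 2 by rewrite mulr_ge0// sqr_ge0.
nra.
Qed.

Section Model.
Variables (sigma : R) (m n : nat) (pi0 : nat -> R) (pi : 'I_m -> nat -> R).
Hypothesis sigma_gt0 : 0 < sigma.
Hypothesis prior0 : positive_prior 0 m pi0.
Hypothesis prior : forall j, positive_prior 1 n (pi j).
Hypothesis PH : forall j, assumption_P gamma n (pi j).

Lemma prior_le1 (a b k : nat) (p : nat -> R) :
  positive_prior a b p -> (a <= k <= b)%N -> p k <= 1.
Proof.
move=> [p0 <-] /andP[ak kb].
rewrite (big_cat_nat (n := k))//=; last exact: leqW.
rewrite [X in _ + X]big_ltn//= [leRHS]addrCA lerDl addr_ge0//.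
- rewrite big_nat sumr_ge0// => i /andP[ai ik]; apply/ltW/p0.
  by rewrite ai (leq_trans (ltnW ik)).
- rewrite big_nat sumr_ge0// => i /andP[ki ib]; apply/ltW/p0.
  by rewrite (leq_trans ak (ltnW ki)).
Qed.

Lemma support_weight_gt0 j (T : {set 'I_n}) : 0 < support_weight (pi j) T.
Proof.
rewrite /support_weight; case: eqP => [//|/eqP T0].
have Tn : (#|T| <= n)%N by rewrite -[n in (_ <= n)%N]card_ord max_card.
rewrite divr_gt0 ?ltr0n ?bin_gt0//.
by apply: (prior j).1; rewrite Tn andbT card_gt0.
Qed.

Lemma ln_support_weight_le j (T : {set 'I_n}) :
  c_gamma gamma * #|T|%:R <= - ln (support_weight (pi j) T).
Proof.
rewrite lerNr -[leRHS]expRK.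
rewrite ler_ln ?posrE ?expR_gt0 ?support_weight_gt0// /support_weight.
case: eqP => [->|/eqP T0]; first by rewrite cards0 mulr0 oppr0 expR0.
have Tn : (#|T| <= n)%N by rewrite -[n in (_ <= n)%N]card_ord max_card.
rewrite ler_pdivrMr ?ltr0n ?bin_gt0// mulrC.
by apply: PH; rewrite Tn andbT card_gt0.
Qed.

Lemma active_le (S : {ffun 'I_m -> {set 'I_n}}) : (#|active S| <= m)%N.
Proof. by rewrite -[m in (_ <= m)%N]card_ord max_card. Qed.

Lemma between_weight_gt0 k : (k <= m)%N -> 0 < pi0 k / 'C(m, k)%:R.
Proof. by move=> km; rewrite divr_gt0 ?ltr0n ?bin_gt0//; apply: prior0.1. Qed.

Lemma model_weight_gt0 (S : {ffun 'I_m -> {set 'I_n}}) :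
  0 < model_weight pi0 pi S.
Proof.
rewrite mulr_gt0 ?between_weight_gt0 ?active_le//.
by rewrite prodr_gt0// => j _; exact: support_weight_gt0.
Qed.

Lemma ln_model_weightE (S : {ffun 'I_m -> {set 'I_n}}) :
  ln (model_weight pi0 pi S) =
  ln (pi0 #|active S| / 'C(m, #|active S|)%:R)
  + \sum_j ln (support_weight (pi j) (S j)).
Proof.
rewrite /model_weight lnM ?posrE ?between_weight_gt0 ?active_le//.
  by rewrite ln_prod// => j; exact: support_weight_gt0.
by rewrite prodr_gt0// => j _; exact: support_weight_gt0.
Qed.

(** Assumption (P) summed over the groups; the weight of the set of active
    groups is at most 1. *)
Lemma ln_model_weight_le (S : {ffun 'I_m -> {set 'I_n}}) :
  c_gamma gamma * \sum_j #|S j|%:R <= - ln (model_weight pi0 pi S).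
Proof.
rewrite ln_model_weightE opprD -sumrN mulr_sumr -[leLHS]add0r lerD//.
  rewrite oppr_ge0 ln_le0// ler_pdivrMr ?ltr0n ?bin_gt0 ?active_le// mul1r.
  apply: (le_trans (prior_le1 prior0 _)); rewrite ?active_le//.
  by rewrite ler1n bin_gt0 active_le.
by apply: ler_sum => j _; exact: ln_support_weight_le.
Qed.

Definition supports (rho : m.-tuple (vec R n)) : {ffun 'I_m -> {set 'I_n}} :=
  [ffun j => [set i | coord (tnth rho j) i != 0]%SET].

Lemma supports_eq0 rho j :
  (supports rho j == finset.set0) = (tnth rho j == vzero n).
Proof.
rewrite ffunE; apply/eqP/eqP => [h|->]; last first.
  by apply/setP => i; rewrite !inE /coord tnth_mktuple eqxx.
apply/eq_from_tnth => i; move/setP: h => /(_ i).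
by rewrite !inE /coord tnth_mktuple => /negbFE/eqP.
Qed.

Definition total_penalty (rho : m.-tuple (vec R n)) : R :=
  \sum_(j < m) pen_within sigma gamma n (pi j) (l0norm (tnth rho j))
  + pen_between sigma gamma m pi0 #|[set j | tnth rho j != vzero n]%SET|.

Lemma total_penaltyE rho : total_penalty rho =
  2 * sigma ^+ 2 * (1 + gamma^-1) *
  (- ln (model_weight pi0 pi (supports rho))
   + (\sum_j #|supports rho j|%:R) / 2 * ln (1 + gamma)).
Proof.
rewrite /total_penalty.
have -> : [set j | tnth rho j != vzero n]%SET = active (supports rho).
  by apply/setP => j; rewrite /active !inE supports_eq0.
rewrite ln_model_weightE opprD -addrA [X in _ = X]mulrDr [RHS]addrC.
congr (_ + _); last first.
  rewrite /pen_between; congr (_ * _).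
  by rewrite -lnV ?posrE ?between_weight_gt0 ?active_le// invfM invrK.
rewrite -sumrN mulr_suml mulr_suml -big_split/= mulr_sumr.
apply: eq_bigr => j _; rewrite /pen_within /l0norm.
have -> : [set i | coord (tnth rho j) i != 0]%SET = supports rho j by rewrite ffunE.
have g1 : 0 < 1 + gamma by move: gamma_gt0; lra.
have [T0|T0] := eqVneq (supports rho j) finset.set0.
  by rewrite T0 cards0 eqxx /support_weight eqxx ln1 oppr0 !mul0r addr0 mulr0.
have Tn : (#|supports rho j| <= n)%N by rewrite -[n in (_ <= n)%N]card_ord max_card.
have p0 : 0 < pi j #|supports rho j|.
  by apply: (prior j).1; rewrite Tn andbT card_gt0.
rewrite /support_weight cards_eq0 (negbTE T0); congr (_ * _).
rewrite [ln (_ * _ `^ _)]lnM ?posrE ?powR_gt0//; last first.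
  by rewrite mulr_gt0 ?invr_gt0// ltr0n bin_gt0.
rewrite ln_powR; congr (_ + _).
by rewrite -lnV ?posrE ?divr_gt0 ?ltr0n ?bin_gt0// invfM invrK.
Qed.

(** The contribution of a coordinate to the exponential moment of the cross
    term, for a coordinate in the support ([hit_factor], normalized to have
    expectation 1) and for one off the support with true mean [u]
    ([miss_factor], of expectation at most 1). *)
Definition hit_factor (x : R) : R :=
  expR (2 * gamma / (1 + 2 * gamma) / (2 * sigma ^+ 2) * x ^+ 2
        - ln (1 + 2 * gamma) / 2).

Definition miss_factor (u x : R) : R :=
  expR (moment_coef / sigma ^+ 2 * (- 2 * u * x - split_coef * u ^+ 2)).

Definition model_term (mu : m.-tuple (vec R n))
    (S : {ffun 'I_m -> {set 'I_n}}) (j : 'I_m) (i : 'I_n) (x : R) : R :=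
  if i \in S j then hit_factor x else miss_factor (coord (tnth mu j) i) x.

Definition model_mixture (mu : m.-tuple (vec R n)) (e : m.-tuple (vec R n)) : R :=
  \sum_(S : {ffun 'I_m -> {set 'I_n}}) model_weight pi0 pi S *
    \prod_j \prod_i model_term mu S j i (tnth (tnth e j) i).

(** The likelihood ratio of a translation by [- w]. *)
Definition shift_density (w : m.-tuple (vec R n)) (e : m.-tuple (vec R n)) : R :=
  \prod_j \prod_i expR (- coord (tnth w j) i * tnth (tnth e j) i / sigma ^+ 2
    - (- coord (tnth w j) i) ^+ 2 / (2 * sigma ^+ 2)).

Lemma model_term_ge0 mu S j i x : 0 <= model_term mu S j i x.
Proof. by rewrite /model_term; case: ifP => _; exact: expR_ge0. Qed.

Lemma model_mixture_ge0 mu e : 0 <= model_mixture mu e.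
Proof.
rewrite sumr_ge0// => S _; rewrite mulr_ge0//.
  exact/ltW/model_weight_gt0.
by rewrite prodr_ge0// => j _; rewrite prodr_ge0// => i _; exact: model_term_ge0.
Qed.

(** What remains of 2 e (rho - mu) at one coordinate once theta (rho - mu)^2 is
    set apart: by Young's inequality where rho is nonzero, exactly where rho
    vanishes. *)
Definition cross_term (mu rho e : m.-tuple (vec R n)) (j : 'I_m) (i : 'I_n) : R :=
  let u := coord (tnth mu j) i in let x := tnth (tnth e j) i in
  if i \in supports rho j then x ^+ 2 / split_coef
  else - 2 * u * x - split_coef * u ^+ 2.

(** The mixture is at least the term of the support of [rho], whatever
    [rho] is, and that term is an exponential; then 1 + x <= exp x. *)
Lemma cross_terms_le (mu rho e : m.-tuple (vec R n)) :
  moment_coef / sigma ^+ 2 * \sum_j \sum_i cross_term mu rho e j i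
  <= - ln (model_weight pi0 pi (supports rho))
     + (\sum_j #|supports rho j|%:R) / 2 * ln (1 + 2 * gamma)
     + model_mixture mu e.
Proof.
set S := supports rho.
pose xi j i := moment_coef / sigma ^+ 2 * cross_term mu rho e j i
  - (if i \in S j then ln (1 + 2 * gamma) / 2 else 0).
have sum_xi : \sum_j \sum_i xi j i =
    moment_coef / sigma ^+ 2 * \sum_j \sum_i cross_term mu rho e j i
    - (\sum_j #|S j|%:R) / 2 * ln (1 + 2 * gamma).
  rewrite mulr_sumr -mulrA mulr_suml -sumrB; apply: eq_bigr => j _.
  rewrite sumrB mulr_sumr; congr (_ - _).
  by rewrite -big_mkcond sumr_const -[LHS]mulr_natl [_ / 2]mulrC.
have s0 := sigma_gt0; have g0 := gamma_gt0.
have sc := split_coef_gt0.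
have term_xi : model_weight pi0 pi S *
    \prod_j \prod_i model_term mu S j i (tnth (tnth e j) i)
    = expR (ln (model_weight pi0 pi S) + \sum_j \sum_i xi j i).
  rewrite expRD lnK ?posrE ?model_weight_gt0//; congr (_ * _).
  rewrite expR_sum; apply: eq_bigr => j _; rewrite expR_sum.
  apply: eq_bigr => i _; rewrite /model_term /xi /cross_term.
  rewrite -/S; case: ifP => _; congr expR; last by rewrite subr0.
  congr (_ - _); rewrite /moment_coef; field.
  by rewrite !gt_eqF//; lra.
have : expR (ln (model_weight pi0 pi S) + \sum_j \sum_i xi j i) <= model_mixture mu e.
  rewrite -term_xi /model_mixture (bigD1 S)//= lerDl sumr_ge0// => S' _.
  rewrite mulr_ge0//; first exact/ltW/model_weight_gt0.
  by rewrite prodr_ge0// => j _; rewrite prodr_ge0// => i _; exact: model_term_ge0.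
have := expR_ge1Dx (ln (model_weight pi0 pi S) + \sum_j \sum_i xi j i).
rewrite sum_xi; lra.
Qed.

Lemma coord_split (u r x : R) :
  2 * x * (r - u) <= split_coef * (r - u) ^+ 2 +
  (if r != 0 then x ^+ 2 / split_coef else - 2 * u * x - split_coef * u ^+ 2).
Proof.
have sc := split_coef_gt0.
case: eqP => [->|_] /=; first by rewrite sub0r sqrrN; lra.
rewrite -subr_ge0 (_ : _ - _ = split_coef * (r - u - x / split_coef) ^+ 2).
  by rewrite mulr_ge0 ?sqr_ge0// ltW.
by field; rewrite gt_eqF.
Qed.

Lemma shift_densityE (w e : m.-tuple (vec R n)) :
  shift_density w e = expR (- (\sum_j \sum_i coord (tnth w j) i * tnth (tnth e j) i) / sigma ^+ 2
    - (\sum_j \sum_i coord (tnth w j) i ^+ 2) / (2 * sigma ^+ 2)).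
Proof.
rewrite -sumrN !mulr_suml -sumrB expR_sum; apply: eq_bigr => j _.
rewrite -sumrN !mulr_suml -sumrB expR_sum; apply: eq_bigr => i _.
by rewrite sqrrN mulNr.
Qed.

Definition gdist (x y : m.-tuple (vec R n)) : R :=
  \sum_j sqdist (tnth x j) (tnth y j).

Definition gsub (x y : m.-tuple (vec R n)) : m.-tuple (vec R n) :=
  [tuple [tuple coord (tnth x j) i - coord (tnth y j) i | i < n] | j < m].

(** Expand the squares in the minimality inequality.  The cross term with [rho]
    is absorbed by theta |rho - mu|^2, the penalty of [rho] and the mixture; the
    one with [nu] is at most |nu - mu|^2 plus a multiple of a likelihood ratio,
    by 1 + x <= exp x again. *)
Lemma oracle_pointwise (mu nu rho e : m.-tuple (vec R n)) :
  map_objective sigma gamma pi0 pi (gadd mu e) rho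
  <= map_objective sigma gamma pi0 pi (gadd mu e) nu ->
  (1 - split_coef) * gdist rho mu <=
  2 * gdist nu mu + total_penalty nu
  + 2 * sigma ^+ 2 * shift_density (gsub nu mu) e
  + sigma ^+ 2 / moment_coef * model_mixture mu e.
Proof.
have s0 := sigma_gt0; have s2 : 0 < sigma ^+ 2 by rewrite exprn_gt0.
have nc := moment_coef_gt0.
have objE r : map_objective sigma gamma pi0 pi (gadd mu e) r =
    total_penalty r + \sum_j \sum_i (tnth (tnth e j) i) ^+ 2 + gdist r mu
    - 2 * \sum_j \sum_i tnth (tnth e j) i * (coord (tnth r j) i - coord (tnth mu j) i).
  rewrite /map_objective big_split/= -addrA addrC /total_penalty -!addrA.
  congr (_ + (_ + _)); rewrite /gdist mulr_sumr -sumrB -big_split/=.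
  apply: eq_bigr => j _; rewrite /sqdist mulr_sumr -sumrB -big_split/=.
  apply: eq_bigr => i _; rewrite /gadd /vadd /Defs.coord !tnth_mktuple; ring.
rewrite !objE => obj.
have crossle : 2 * \sum_j \sum_i tnth (tnth e j) i *
     (coord (tnth rho j) i - coord (tnth mu j) i)
    <= split_coef * gdist rho mu + \sum_j \sum_i cross_term mu rho e j i.
  rewrite /gdist !mulr_sumr -big_split/=; apply: ler_sum => j _.
  rewrite /sqdist !mulr_sumr -big_split/=; apply: ler_sum => i _.
  have := coord_split (coord (tnth mu j) i) (coord (tnth rho j) i) (tnth (tnth e j) i).
  by rewrite mulrA /cross_term ffunE inE.
have pen : \sum_j \sum_i cross_term mu rho e j i <=
    total_penalty rho + sigma ^+ 2 / moment_coef * model_mixture mu e.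
  have nd : 0 < moment_coef / sigma ^+ 2 by exact: divr_gt0 nc s2.
  have := cross_terms_le mu rho e; rewrite -ler_pdivlMl// => /le_trans; apply.
  rewrite invf_div mulrDr lerD2r total_penaltyE.
  set L := - ln _; set H := \sum_j _.
  have slack : (L + H / 2 * ln (1 + 2 * gamma)) / moment_coef
      <= 2 * (1 + gamma^-1) * (L + H / 2 * ln (1 + gamma)).
    apply: penalty_slack; last exact: ln_model_weight_le.
    exact: sumr_ge0.
  have := ler_wpM2l (ltW s2) slack.
  by rewrite mulrA mulrAC 2![sigma ^+ 2 * (_ * _)]mulrA [sigma ^+ 2 * 2]mulrC.
have shift : - (2 * \sum_j \sum_i tnth (tnth e j) i * (coord (tnth nu j) i - coord (tnth mu j) i))
   <= gdist nu mu + 2 * sigma ^+ 2 * shift_density (gsub nu mu) e.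
  rewrite shift_densityE.
  have -> : \sum_j \sum_i coord (tnth (gsub nu mu) j) i * tnth (tnth e j) i =
     \sum_j \sum_i tnth (tnth e j) i * (coord (tnth nu j) i - coord (tnth mu j) i).
    apply: eq_bigr => j _; apply: eq_bigr => i _.
    by rewrite /gsub /Defs.coord !tnth_mktuple mulrC.
  have -> : \sum_j \sum_i coord (tnth (gsub nu mu) j) i ^+ 2 = gdist nu mu.
    apply: eq_bigr => j _; apply: eq_bigr => i _.
    by rewrite /gsub /Defs.coord !tnth_mktuple.
  set X := \sum_j _; set D := gdist _ _.
  have h := expR_ge1Dx (- X / sigma ^+ 2 - D / (2 * sigma ^+ 2)).
  have h' : 2 * sigma ^+ 2 * (- X / sigma ^+ 2 - D / (2 * sigma ^+ 2)) <=
     2 * sigma ^+ 2 * expR (- X / sigma ^+ 2 - D / (2 * sigma ^+ 2)).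
    by rewrite ler_pM2l ?mulr_gt0//; lra.
  have hE : 2 * sigma ^+ 2 * (- X / sigma ^+ 2 - D / (2 * sigma ^+ 2)) = - 2 * X - D.
    by field; rewrite gt_eqF.
  lra.
lra.
Qed.

Lemma measurable_hit_factor :
  measurable_fun setT (hit_factor : measurableTypeR R -> R).
Proof.
apply: measurable_expR_comp; apply: measurable_funB => //.
by apply: measurable_funM => //; exact: measurable_funX.
Qed.

Lemma measurable_miss_factor u :
  measurable_fun setT (miss_factor u : measurableTypeR R -> R).
Proof.
apply: measurable_expR_comp; apply: measurable_funM => //.
by apply: measurable_funB => //; exact: measurable_funM.
Qed.

Lemma measurable_shift_factor (u : R) :
  measurable_fun setT (fun x : measurableTypeR R =>
    expR (u * x / sigma ^+ 2 - u ^+ 2 / (2 * sigma ^+ 2))).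
Proof.
apply: measurable_expR_comp; apply: measurable_funB => //.
by apply: measurable_funM => //; exact: measurable_funM.
Qed.

Lemma integral_hit_factor :
  (\int[normal_prob 0 sigma]_x (hit_factor x)%:E = 1)%E.
Proof.
have g0 : 0 <= 2 * gamma by move: gamma_gt0; lra.
have g1 : 0 < 1 + 2 * gamma by move: gamma_gt0; lra.
have E x : ((hit_factor x)%:E = (expR (- (ln (1 + 2 * gamma) / 2)))%:E *
   (expR (2 * gamma / (1 + 2 * gamma) / (2 * sigma ^+ 2) * x ^+ 2))%:E)%E.
  by rewrite -EFinM -expRD addrC.
under eq_integral do rewrite E.
rewrite (@ge0_integralZl_EFin _ _ _ (normal_prob 0 sigma) setT) ?expR_ge0//.
- rewrite gauss_exp_square// -EFinM -powR12_sqrt ?ltW// /powR gt_eqF//.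
  by rewrite -expRD mulrC addNr expR0.
- apply: measurable_fun_EFin; apply: measurable_expR_comp.
  by apply: measurable_funM => //; exact: measurable_funX.
Qed.

(** Completing the square leaves an exponent proportional to
    2 [moment_coef] - [split_coef], which is nonpositive. *)
Lemma integral_miss_factor (u : R) :
  (\int[normal_prob 0 sigma]_x (miss_factor u x)%:E <= 1)%E.
Proof.
have s0 := sigma_gt0; have s2 : 0 < sigma ^+ 2 by rewrite exprn_gt0.
rewrite -(gauss_exp_linear s0 (- 2 * moment_coef * u)).
apply: ge0_le_integral => //.
- by move=> x _; rewrite lee_fin expR_ge0.
- by apply: measurable_fun_EFin; exact: measurable_miss_factor.
- by apply: measurable_fun_EFin; exact: measurable_shift_factor.
- move=> x _; rewrite lee_fin ler_expR -subr_ge0.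
  have -> : - 2 * moment_coef * u * x / sigma ^+ 2 -
     (- 2 * moment_coef * u) ^+ 2 / (2 * sigma ^+ 2) -
     moment_coef / sigma ^+ 2 * (- 2 * u * x - split_coef * u ^+ 2)
    = moment_coef * (split_coef - 2 * moment_coef) * (u ^+ 2 / sigma ^+ 2).
    by field; rewrite gt_eqF.
  rewrite mulr_ge0 ?divr_ge0 ?sqr_ge0 ?(ltW s2)//.
  have h : 0 <= split_coef - 2 * moment_coef by rewrite subr_ge0 moment_coef_le.
  exact: (mulr_ge0 (ltW moment_coef_gt0) h).
Qed.

Lemma integral_group_prod_le (f : 'I_m -> 'I_n -> measurableTypeR R -> R) :
  (forall j i, measurable_fun setT (f j i)) -> (forall j i x, 0 <= f j i x) ->
  (forall j i, \int[normal_prob 0 sigma]_x (f j i x)%:E <= 1)%E ->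
  (\int[group_noise sigma m n]_e
     (\prod_j \prod_i f j i (tnth (tnth e j) i))%:E <= 1)%E.
Proof.
move=> mf f0 f1.
have prod1 k : \prod_(i < k) 1 = 1 :> R by rewrite big1.
rewrite -[leRHS]/(1%:E) -[X in (_ <= X%:E)%E](prod1 m).
apply: (@integral_iid_law_prod_le _ _ R (gauss_noise sigma n) m
  (fun j v => \prod_i f j i (tnth v i)) (fun=> 1)).
- by move=> j; exact: measurable_prod_tnth.
- by move=> j v; rewrite prodr_ge0.
- move=> j; rewrite -[X in (_ <= X%:E)%E](prod1 n).
  exact: (@integral_iid_law_prod_le _ _ R (normal_prob 0 sigma) n (f j) (fun=> 1)).
Qed.

Lemma measurable_group_prod (f : 'I_m -> 'I_n -> measurableTypeR R -> R) :
  (forall j i, measurable_fun setT (f j i)) ->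
  measurable_fun setT (fun e : m.-tuple (vec R n) =>
    \prod_j \prod_i f j i (tnth (tnth e j) i)).
Proof.
move=> mf; apply: (@measurable_prod_tnth _ _ R m (fun j (v : vec R n) => \prod_i f j i (tnth v i))).
by move=> j; exact: measurable_prod_tnth.
Qed.

Lemma measurable_model_term mu S j i :
  measurable_fun setT (model_term mu S j i : measurableTypeR R -> R).
Proof.
rewrite /model_term; case: (i \in S j); first exact: measurable_hit_factor.
exact: measurable_miss_factor.
Qed.

Lemma measurable_model_mixture mu : measurable_fun setT (model_mixture mu).
Proof.
apply: measurable_sum => S; apply: measurable_funM => //.
by apply: measurable_group_prod => j i; exact: measurable_model_term.
Qed.

Lemma integral_model_mixture mu :
  (\int[group_noise sigma m n]_e (model_mixture mu e)%:E <= 1)%E.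
Proof.
have w0 (S : {ffun 'I_m -> {set 'I_n}}) : 0 <= model_weight pi0 pi S by exact/ltW/model_weight_gt0.
have p0 S e : 0 <= \prod_j \prod_i model_term mu S j i (tnth (tnth e j) i).
  by rewrite prodr_ge0// => j _; rewrite prodr_ge0// => i _; exact: model_term_ge0.
have mP S : measurable_fun setT (fun e : m.-tuple (vec R n) =>
   \prod_j \prod_i model_term mu S j i (tnth (tnth e j) i)).
  by apply: measurable_group_prod => j i; exact: measurable_model_term.
under eq_integral do rewrite /model_mixture -sumEFin.
rewrite ge0_integral_sum//; last 2 first.
- by move=> S; apply: measurable_fun_EFin; exact: measurable_funM.
- by move=> S e _; rewrite lee_fin mulr_ge0.
rewrite -[leRHS]/(1%:E) -[X in (_ <= X%:E)%E](sum_model_weight prior0 prior).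
rewrite -sumEFin; apply: lee_sum => S _.
under eq_integral do rewrite EFinM.
rewrite (@ge0_integralZl_EFin _ _ _ (group_noise sigma m n) setT)//; last 2 first.
- by move=> e _; rewrite lee_fin.
- exact: measurable_fun_EFin.
rewrite -[leRHS]mule1 lee_wpmul2l ?lee_fin//.
apply: integral_group_prod_le => j i; first exact: measurable_model_term.
- by move=> x; exact: model_term_ge0.
- rewrite /model_term; case: (i \in S j); last exact: integral_miss_factor.
  by rewrite integral_hit_factor.
Qed.

Lemma measurable_shift_density w : measurable_fun setT (shift_density w).
Proof.
apply: (@measurable_group_prod (fun j i x => expR (- coord (tnth w j) i * x / sigma ^+ 2
    - (- coord (tnth w j) i) ^+ 2 / (2 * sigma ^+ 2)))) => j i.
exact: measurable_shift_factor.
Qed.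

Lemma integral_shift_density w :
  (\int[group_noise sigma m n]_e (shift_density w e)%:E <= 1)%E.
Proof.
apply: (@integral_group_prod_le (fun j i x => expR (- coord (tnth w j) i * x / sigma ^+ 2
    - (- coord (tnth w j) i) ^+ 2 / (2 * sigma ^+ 2)))) => j i.
- exact: measurable_shift_factor.
- by move=> x; exact: expR_ge0.
- by rewrite gauss_exp_linear.
Qed.

Lemma total_penalty_ge0 rho : 0 <= total_penalty rho.
Proof.
have g0 := gamma_gt0; have s2 : 0 <= sigma ^+ 2 by rewrite sqr_ge0.
have gV : 0 <= 1 + gamma^-1 by rewrite addr_ge0// invr_ge0 ltW.
have H0 : 0 <= \sum_j #|supports rho j|%:R :> R by exact: sumr_ge0.
have c0 : 0 <= c_gamma gamma by rewrite mulr_ge0// sqr_ge0.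
have L0 : 0 <= - ln (model_weight pi0 pi (supports rho)).
  by apply: le_trans (ln_model_weight_le _); exact: mulr_ge0.
have ln0 : 0 <= ln (1 + gamma) by apply: ln_ge0; lra.
rewrite total_penaltyE; apply: mulr_ge0; first exact: mulr_ge0 (mulr_ge0 _ s2) gV.
by apply: addr_ge0 => //; apply: mulr_ge0 => //; exact: divr_ge0.
Qed.

Lemma gdist_ge0 x y : 0 <= gdist x y.
Proof. by apply: sumr_ge0 => j _; exact: sqdist_ge0. Qed.

Lemma group_riskE (muhat : m.-tuple (vec R n) -> m.-tuple (vec R n)) mu :
  measurable_fun setT muhat ->
  group_risk sigma muhat mu =
  (\int[group_noise sigma m n]_e (gdist (muhat (gadd mu e)) mu)%:E)%E.
Proof.
move=> mh; rewrite /group_risk -ge0_integral_sum//.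
- by apply: eq_integral => e _; rewrite sumEFin.
- move=> j; apply: measurable_fun_EFin; apply: measurable_sqdist.
  apply: (measurableT_comp (measurable_tnth j)).
  by apply: (measurableT_comp mh); exact: measurable_gadd.
- by move=> j e _; rewrite lee_fin sqdist_ge0.
Qed.

(** Both random terms of [oracle_pointwise] have expectation at most 1, so
    integrating it costs only a multiple of sigma^2. *)
Lemma oracle_inequality muhat mu nu :
  map_estimator sigma gamma pi0 pi muhat ->
  (group_risk sigma muhat mu <=
   ((1 - split_coef)^-1 * (2 * gdist nu mu + total_penalty nu
     + 2 * sigma ^+ 2 + sigma ^+ 2 / moment_coef))%:E)%E.
Proof.
move=> [mh minh]; rewrite group_riskE//.
have s2 : 0 <= sigma ^+ 2 by exact: sqr_ge0.
have nc : 0 <= sigma ^+ 2 / moment_coef by exact: divr_ge0 s2 (ltW moment_coef_gt0).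
have sc : 0 < 1 - split_coef by rewrite subr_gt0 split_coef_lt1.
have D0 w e : 0 <= shift_density w e.
  by rewrite shift_densityE expR_ge0.
pose a := (1 - split_coef)^-1 * (2 * gdist nu mu + total_penalty nu).
pose b := (1 - split_coef)^-1 * (2 * sigma ^+ 2).
pose c := (1 - split_coef)^-1 * (sigma ^+ 2 / moment_coef).
have sV : 0 <= (1 - split_coef)^-1 by rewrite invr_ge0 ltW.
have a0 : 0 <= a.
  apply: mulr_ge0 sV _; apply: addr_ge0; last exact: total_penalty_ge0.
  by apply: mulr_ge0 => //; exact: gdist_ge0.
have b0 : 0 <= b by apply: mulr_ge0 sV _; exact: mulr_ge0.
have c0 : 0 <= c by exact: mulr_ge0.
rewrite (_ : _ * _ = a + b + c); last by rewrite /a /b /c -!mulrDr.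
have mD := measurable_shift_density (gsub nu mu).
have mM := measurable_model_mixture mu.
apply: le_trans (integral_affine_le a0 b0 c0 mD mM (D0 _) (model_mixture_ge0 mu)
  (integral_shift_density _) (integral_model_mixture mu)).
apply: ae_ge0_le_integral => //.
- by move=> e _; rewrite lee_fin gdist_ge0.
- apply: measurable_fun_EFin; apply: measurable_sum => j; apply: measurable_sqdist.
  apply: (measurableT_comp (measurable_tnth j)).
  by apply: (measurableT_comp mh); exact: measurable_gadd.
- move=> e _; rewrite lee_fin addr_ge0 ?addr_ge0//; apply: mulr_ge0 => //.
  exact: model_mixture_ge0.
- apply: measurable_fun_EFin; apply: measurable_funD; last exact: measurable_funM.
  by apply: measurable_funD => //; exact: measurable_funM.
- apply: filterS (minh mu) => e mine _; rewrite lee_fin.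
  have := oracle_pointwise (mine nu).
  rewrite mulrC -ler_pdivlMr// => /le_trans; apply.
  by rewrite [_ / (1 - _)]mulrC /a /b /c !mulrDr !mulrA.
Qed.

End Model.
End Oracle.

(** * Testing two translations of the Gaussian noise *)

Section PairTest.
Variables (R : realType) (sigma : R) (n : nat).
Hypothesis sigma_gt0 : 0 < sigma.

Local Notation gauss := (gauss_noise sigma n).

Definition likelihood (u z : vec R n) : R :=
  \prod_i expR (coord u i * tnth z i / sigma ^+ 2 - coord u i ^+ 2 / (2 * sigma ^+ 2)).

Lemma likelihood_ge0 u z : 0 <= likelihood u z.
Proof. by rewrite prodr_ge0// => i _; exact: expR_ge0. Qed.

Lemma measurable_likelihood u : measurable_fun setT (likelihood u).
Proof.
apply: (@measurable_prod_tnth _ _ R n (fun i x =>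
  expR (coord u i * x / sigma ^+ 2 - coord u i ^+ 2 / (2 * sigma ^+ 2)))) => i.
exact: measurable_shift_factor.
Qed.

Lemma gauss_noise_shift (u : vec R n) (g : vec R n -> \bar R) :
  measurable_fun setT g -> (forall z, 0 <= g z)%E ->
  (\int[gauss]_z g (vadd u z) = \int[gauss]_z (g z * (likelihood u z)%:E))%E.
Proof.
move=> mg g0.
apply: (@integral_iid_law_map _ _ R (normal_prob 0 sigma) n
  (fun i (x : measurableTypeR R) => coord u i + x)
  (fun i x => expR (coord u i * x / sigma ^+ 2 - coord u i ^+ 2 / (2 * sigma ^+ 2)))) => //.
- by move=> i; exact: measurable_addl.
- by move=> i; exact: measurable_shift_factor.
- by move=> i h mh h0; exact: gauss_shift.
Qed.

Lemma integral_likelihood u : (\int[gauss]_z (likelihood u z)%:E = 1)%E.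
Proof.
have := @gauss_noise_shift u (fun=> 1%E) (measurable_cst _) (fun=> lee01).
under [in RHS]eq_integral do rewrite mul1e.
move=> <-; rewrite integral_cst// mul1e; exact: probability_setT.
Qed.

Definition vnorm2 (u : vec R n) : R := \sum_i coord u i ^+ 2.

(** The square of the likelihood ratio of a translation is a multiple of the
    likelihood ratio of the doubled translation. *)
Lemma integral_likelihood2 u :
  (\int[gauss]_z (likelihood u z ^+ 2)%:E = (expR (vnorm2 u / sigma ^+ 2))%:E)%E.
Proof.
pose u2 : vec R n := [tuple 2 * coord u i | i < n].
have E z : ((likelihood u z ^+ 2)%:E =
    (expR (vnorm2 u / sigma ^+ 2))%:E * (likelihood u2 z)%:E)%E.
  rewrite -EFinM /likelihood -prodrXl /vnorm2 mulr_suml expR_sum -big_split/=.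
  congr EFin; apply: eq_bigr => i _.
  have -> : coord u2 i = 2 * coord u i by rewrite /u2 /Defs.coord tnth_mktuple.
  rewrite -expRD -expRM_natl; congr expR.
  by field; rewrite gt_eqF.
under eq_integral do rewrite E -EFinM.
rewrite integral_scale ?expR_ge0 ?integral_likelihood ?mule1//.
- exact: measurable_likelihood.
- exact: likelihood_ge0.
Qed.

(** The minimum over x of x^2 + q (x - t)^2 is t^2 q / (1 + q); the terms in v
    come from the tangent of 1 / (1 + q) at 1 + q = v.  After this linearization
    only the first two moments of a likelihood ratio are needed. *)
Lemma two_point_ineq (x t q v : R) : 0 <= q -> 0 < v ->
  2 * t ^+ 2 / v * q <=
  x ^+ 2 + q * (x - t) ^+ 2 + t ^+ 2 / v ^+ 2 * (q + q ^+ 2).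
Proof.
move=> q0 v0; have q1 : 0 < 1 + q by lra.
rewrite -(ler_pM2l q1) -subr_ge0.
have -> : (1 + q) * (x ^+ 2 + q * (x - t) ^+ 2 + t ^+ 2 / v ^+ 2 * (q + q ^+ 2))
  - (1 + q) * (2 * t ^+ 2 / v * q) =
  (x + q * (x - t)) ^+ 2 + q * (t * (1 - (1 + q) / v)) ^+ 2.
  by field; rewrite gt_eqF.
by rewrite addr_ge0 ?sqr_ge0// mulr_ge0// sqr_ge0.
Qed.

(** With weights 1 and 1/b on the two hypotheses, no estimate of the coordinate
    has a risk below const t^2 / b.  The condition on [t] keeps the second
    moment of the weighted likelihood ratio q bounded by e / b, that is, of the
    order of its first moment 1 / b. *)
Lemma two_point_test (d : vec R n -> R) (mu u : vec R n) (p t b : R) :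
  measurable_fun setT d -> 0 < b -> vnorm2 u = t ^+ 2 ->
  expR (t ^+ 2 / sigma ^+ 2) <= expR 1 * b ->
  ((t ^+ 2 / ((1 + expR 1) * b))%:E <=
   \int[gauss]_z ((d (vadd mu z) - p) ^+ 2)%:E +
   b^-1%:E * \int[gauss]_z ((d (vadd (vadd mu u) z) - (p + t)) ^+ 2)%:E)%E.
Proof.
move=> md b0 ut tb; pose e : R := expR 1.
have e0 : 0 < e by exact: expR_gt0.
have v0 : 0 < 1 + e by lra.
pose g z : \bar R := ((d (vadd mu z) - (p + t)) ^+ 2)%:E.
have mdmu : measurable_fun setT (fun z => d (vadd mu z)).
  by apply: (measurableT_comp md); exact: measurable_vadd.
have msq c : measurable_fun setT (fun z => ((d (vadd mu z) - c) ^+ 2)).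
  by apply: measurable_funX; exact: measurable_funB.
have mL := measurable_likelihood u.
have L0 := likelihood_ge0 u.
have bV : 0 <= b^-1 by rewrite invr_ge0 ltW.
have -> : (\int[gauss]_z ((d (vadd (vadd mu u) z) - (p + t)) ^+ 2)%:E =
           \int[gauss]_z (g z * (likelihood u z)%:E))%E.
  rewrite -gauss_noise_shift//; last 2 first.
  - exact: measurable_fun_EFin.
  - by move=> z; rewrite lee_fin sqr_ge0.
  apply: eq_integral => z _; rewrite /g; congr (((d _ - _) ^+ 2)%:E).
  by apply/eq_from_tnth => i; rewrite /vadd /Defs.coord !tnth_mktuple addrA.
set I0 := (\int[gauss]_z _)%E; set I1 := (\int[gauss]_z _)%E.
pose q z := b^-1 * likelihood u z.
have q0 z : 0 <= q z by exact: mulr_ge0.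
have mq : measurable_fun setT q by exact: measurable_funM.
have intq : (\int[gauss]_z (q z)%:E = b^-1%:E)%E.
  by rewrite integral_scale// integral_likelihood mule1.
have mq2 : measurable_fun setT (fun z => q z ^+ 2) by exact: measurable_funX.
have intq2 : (\int[gauss]_z (q z ^+ 2)%:E =
    (b^-1 ^+ 2 * expR (t ^+ 2 / sigma ^+ 2))%:E)%E.
  rewrite -ut EFinM -integral_likelihood2 -integral_scale ?sqr_ge0//.
  - by apply: eq_integral => z _; rewrite /q exprMn.
  - exact: measurable_funX.
  - by move=> z; exact: sqr_ge0.
pose k := t ^+ 2 / (1 + e) ^+ 2.
have k0 : 0 <= k by apply: divr_ge0; exact: sqr_ge0.
pose h := 2 * t ^+ 2 / (1 + e).
have h0 : 0 <= h by apply: divr_ge0; [rewrite mulr_ge0 ?sqr_ge0|exact: ltW].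
have main : ((h * b^-1)%:E <=
   I0 + b^-1%:E * I1 + (k * (b^-1 + b^-1 ^+ 2 * expR (t ^+ 2 / sigma ^+ 2)))%:E)%E.
  have -> : ((h * b^-1)%:E = \int[gauss]_z (h * q z)%:E)%E.
    by rewrite integral_scale// intq.
  have -> : (b^-1%:E * I1 = \int[gauss]_z (q z * (d (vadd mu z) - (p + t)) ^+ 2)%:E)%E.
    rewrite /I1; under eq_integral do rewrite /g -EFinM.
    rewrite -integral_scale//.
    - by apply: eq_integral => z _; congr EFin; rewrite [_ * likelihood u z]mulrC mulrA.
    - exact: measurable_funM.
    - by move=> z; rewrite mulr_ge0 ?sqr_ge0.
  have -> : ((k * (b^-1 + b^-1 ^+ 2 * expR (t ^+ 2 / sigma ^+ 2)))%:E =
      \int[gauss]_z (k * (q z + q z ^+ 2))%:E)%E.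
    rewrite integral_scale//; last 2 first.
    - exact: measurable_funD.
    - by move=> z; rewrite addr_ge0// sqr_ge0.
    rewrite EFinM EFinD -intq -intq2; congr (_ * _)%E.
    under [RHS]eq_integral do rewrite EFinD.
    rewrite ge0_integralD//.
    + by move=> z _; rewrite lee_fin.
    + exact: measurable_fun_EFin.
    + by move=> z _; rewrite lee_fin sqr_ge0.
    + exact: measurable_fun_EFin.
  rewrite /I0 -ge0_integralD//; last 4 first.
  - by move=> z _; rewrite lee_fin sqr_ge0.
  - exact: measurable_fun_EFin.
  - by move=> z _; rewrite lee_fin mulr_ge0// sqr_ge0.
  - by apply: measurable_fun_EFin; exact: measurable_funM.
  rewrite -ge0_integralD//; last 4 first.
  - by move=> z _; rewrite adde_ge0// lee_fin ?sqr_ge0// mulr_ge0// sqr_ge0.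
  - apply: emeasurable_funD; first exact: measurable_fun_EFin.
    by apply: measurable_fun_EFin; exact: measurable_funM.
  - by move=> z _; rewrite lee_fin mulr_ge0// addr_ge0// sqr_ge0.
  - apply: measurable_fun_EFin; apply: measurable_funM => //.
    by apply: measurable_funD => //; exact: measurable_funX.
  apply: ge0_le_integral => //.
  - by move=> z _; rewrite lee_fin mulr_ge0.
  - by apply: measurable_fun_EFin; exact: measurable_funM.
  - apply: emeasurable_funD; first apply: emeasurable_funD.
    + exact: measurable_fun_EFin.
    + by apply: measurable_fun_EFin; exact: measurable_funM.
    + apply: measurable_fun_EFin; apply: measurable_funM => //.
      by apply: measurable_funD => //; exact: measurable_funX.
  - move=> z _; rewrite -!EFinD lee_fin.
    have -> : d (vadd mu z) - (p + t) = d (vadd mu z) - p - t by ring.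
    exact: two_point_ineq.
have kle : k * (b^-1 + b^-1 ^+ 2 * expR (t ^+ 2 / sigma ^+ 2)) <= k * ((1 + e) * b^-1).
  rewrite ler_wpM2l// mulrDl mul1r lerD2l.
  have -> : e * b^-1 = b^-1 ^+ 2 * (e * b) by field; rewrite gt_eqF.
  by rewrite ler_wpM2l// sqr_ge0.
have : ((t ^+ 2 / ((1 + e) * b) + k * (b^-1 + b^-1 ^+ 2 * expR (t ^+ 2 / sigma ^+ 2)))%:E
   <= I0 + b^-1%:E * I1 + (k * (b^-1 + b^-1 ^+ 2 * expR (t ^+ 2 / sigma ^+ 2)))%:E)%E.
  apply: le_trans main; rewrite lee_fin -lerBrDr.
  apply: le_trans (_ : h * b^-1 - k * ((1 + e) * b^-1) <= _); last by rewrite lerD2l lerN2.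
  rewrite le_eqVlt; apply/orP; left; apply/eqP; rewrite /h /k; field.
  by rewrite !gt_eqF.
by rewrite EFinD leeD2rE.
Qed.

End PairTest.

(** * Bayes risk of a random placement of spikes *)

Lemma big_option (R : nmodType) (I : finType) (f : option I -> R) :
  \sum_v f v = f None + \sum_x f (Some x).
Proof.
rewrite (bigD1 None)//=; congr (_ + _).
rewrite (reindex_omap Some id)/=; last by case.
by apply: eq_bigl => x; rewrite eqxx.
Qed.

Section BlockPrior.
Variables (R : realType) (n : nat) (blk : 'I_n -> 'I_n).

Local Notation config := {ffun 'I_n -> option 'I_n}.

Definition block_size (k : 'I_n) : nat := #|[set x | blk x == k]%SET|.

(** Prior law of the spike of block [k]: absent or placed at some [x].  In an
    empty block the spike is certainly absent. *)
Definition place_weight (k : 'I_n) (v : option 'I_n) : R :=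
  if v is Some x then (blk x == k)%:R / (2 * (block_size k)%:R)
  else if block_size k == 0%N then 1 else 2^-1.

Definition config_weight (w : config) : R := \prod_k place_weight k (w k).

Definition place (w : config) (k : 'I_n) (v : option 'I_n) : config :=
  [ffun j => if j == k then v else w j].

Lemma place_weight_ge0 k v : 0 <= place_weight k v.
Proof.
case: v => [x|] /=; last by case: ifP => _; rewrite ?invr_ge0.
by rewrite divr_ge0// mulr_ge0.
Qed.

Lemma config_weight_ge0 w : 0 <= config_weight w.
Proof. by rewrite prodr_ge0// => k _; exact: place_weight_ge0. Qed.

Lemma block_size_gt0 x : (0 < block_size (blk x))%N.
Proof. by rewrite card_gt0; apply/set0Pn; exists x; rewrite inE. Qed.

Lemma sum_place_weight k : \sum_v place_weight k v = 1.
Proof.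
rewrite big_option /=.
have -> : \sum_x (blk x == k)%:R / (2 * (block_size k)%:R) =
    (block_size k)%:R / (2 * (block_size k)%:R) :> R.
  rewrite -mulr_suml; congr (_ / _); rewrite /block_size -sum1_card natr_sum.
  by rewrite [RHS]big_mkcond; apply: eq_bigr => x _; rewrite inE; case: eqP.
have [->|b0] := eqVneq; first by rewrite mul0r addr0.
by field; rewrite pnatr_eq0.
Qed.

Lemma sum_config_weight : \sum_w config_weight w = 1.
Proof.
rewrite -(bigA_distr_bigA place_weight) big1// => k _; exact: sum_place_weight.
Qed.

Lemma sum_config_weight_None k : block_size k != 0%N ->
  \sum_(w : config | w k == None) config_weight w = 2^-1.
Proof.
move=> bk.
transitivity (\sum_(w in family (fun j => [pred v : option 'I_n | (j == k) ==> (v == None)]))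
    config_weight w).
  apply: eq_bigl => w; apply/eqP/familyP => [wk j|/(_ k)].
    by rewrite inE; apply/implyP => /eqP ->; rewrite wk.
  by rewrite inE eqxx => /eqP.
rewrite -(bigA_distr_big_dep (fun j => [pred v : option 'I_n | (j == k) ==> (v == None)])
  place_weight).
rewrite (bigD1 k)//= [X in _ * X]big1 ?mulr1; last first.
  move=> j jk; rewrite -(sum_place_weight j); apply: eq_bigl => v.
  by rewrite (negbTE jk).
rewrite (eq_bigl (pred1 (None : option 'I_n))); last by move=> v; rewrite !inE eqxx.
by rewrite big_pred1_eq /= (negbTE bk).
Qed.

Lemma config_weight_place (w : config) x : w (blk x) = None ->
  config_weight (place w (blk x) (Some x)) =
  config_weight w / (block_size (blk x))%:R.
Proof.
move=> wN; rewrite /config_weight (bigD1 (blk x))//= [in RHS](bigD1 (blk x))//=.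
rewrite wN ffunE eqxx /= eqxx gtn_eqF ?block_size_gt0//.
rewrite (eq_bigr (fun k => place_weight k (w k))); last first.
  by move=> k /negbTE kx; rewrite ffunE kx.
by rewrite [true%:R]/(1%:R) mul1r invfM mulrAC.
Qed.

Lemma sum_config_placed (x : 'I_n) (f : config -> R) :
  \sum_(w : config | w (blk x) == Some x) f w =
  \sum_(w : config | w (blk x) == None) f (place w (blk x) (Some x)).
Proof.
rewrite (reindex_onto (fun w => place w (blk x) (Some x))
  (fun w => place w (blk x) None))/=; last first.
  move=> w /eqP wx; apply/ffunP => j; rewrite !ffunE.
  by case: eqP => // ->.
apply: eq_bigl => w; rewrite ffunE !eqxx /=.
apply/eqP/eqP => [<-|wN]; first by rewrite ffunE eqxx.
by apply/ffunP => j; rewrite !ffunE; case: eqP => // ->.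
Qed.

(** The Bayes risk is a sum over coordinates.  For the coordinate [x] only the
    configurations without spike in the block of [x], and those with the spike
    at [x], are retained; they are matched by [place], and the weights of two
    matched configurations differ by the size of the block. *)
Lemma bayes_blocks (rho : 'I_n -> config -> R) (M c : R) (t : 'I_n -> R) :
  (forall x w, 0 <= rho x w) ->
  (forall x (w : config), w (blk x) = None ->
     c * t (blk x) ^+ 2 / (block_size (blk x))%:R <=
     rho x w + (block_size (blk x))%:R^-1 * rho x (place w (blk x) (Some x))) ->
  (forall w, \sum_x rho x w <= M) ->
  \sum_(k | block_size k != 0%N) c * t k ^+ 2 / 2 <= M.
Proof.
move=> rho0 pair rhoM.
apply: (le_trans (y := \sum_w config_weight w * \sum_x rho x w)); last first.
  rewrite -[leRHS]mul1r -sum_config_weight mulr_suml; apply: ler_sum => w _.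
  by rewrite ler_wpM2l ?config_weight_ge0.
under [leRHS]eq_bigr do rewrite mulr_sumr.
rewrite exchange_big/=.
apply: (le_trans (y := \sum_x c * t (blk x) ^+ 2 / (block_size (blk x))%:R / 2)).
  rewrite [leRHS](partition_big blk xpredT)//= [leLHS]big_mkcond/=.
  apply: ler_sum => k _; case: ifP => [bk|/negbFE/eqP bk].
    rewrite (eq_bigr (fun=> c * t k ^+ 2 / (block_size k)%:R / 2)); last first.
      by move=> x /eqP ->.
    have -> : \sum_(x | blk x == k) c * t k ^+ 2 / (block_size k)%:R / 2
        = (block_size k)%:R * (c * t k ^+ 2 / (block_size k)%:R / 2).
      set y := _ / 2.
      rewrite mulr_natl /block_size -sumr_const; apply: eq_bigl => x.
      by rewrite inE.
    rewrite le_eqVlt; apply/orP; left; apply/eqP; field.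
    by rewrite pnatr_eq0.
  rewrite big1// => x /eqP xk; have := block_size_gt0 x.
  by rewrite xk bk.
apply: ler_sum => x _.
pose P v := [pred w : config | w (blk x) == v].
apply: (le_trans (y := \sum_(w | P None w) config_weight w * rho x w +
   \sum_(w | P (Some x) w) config_weight w * rho x w)); last first.
  rewrite [leRHS](bigID (P None))/= lerD2l.
  rewrite [leRHS](bigID (P (Some x)))/=.
  rewrite [X in _ <= X + _](eq_bigl (P (Some x))); last first.
    by move=> w; rewrite /P/=; case: (w (blk x)).
  rewrite lerDl sumr_ge0// => w _.
  by rewrite mulr_ge0 ?config_weight_ge0.
rewrite /P/= sum_config_placed -big_split/=.
apply: (le_trans (y := \sum_(w : config | w (blk x) == None)
    config_weight w * (c * t (blk x) ^+ 2 / (block_size (blk x))%:R))).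
  rewrite -[leRHS]mulr_suml sum_config_weight_None; last first.
    by rewrite -lt0n block_size_gt0.
  by rewrite [leRHS]mulrC.
apply: ler_sum => w /eqP wN; rewrite config_weight_place//.
by have := ler_wpM2l (config_weight_ge0 w) (pair x w wN); rewrite mulrDr !mulrA.
Qed.

End BlockPrior.

(** * Lower bound for the minimax risk *)

Section MinimaxBlocks.
Variables (R : realType) (sigma : R) (n : nat).
Hypothesis sigma_gt0 : 0 < sigma.

Definition dominated (nu mu : vec R n) : Prop :=
  exists2 f : 'I_n -> 'I_n,
    {in [pred x | coord nu x != 0] &, injective f} &
    forall x, coord nu x != 0 -> `|coord nu x| <= `|coord mu (f x)|.

(** The common property of the three families of balls: they are solid and
    invariant under permutations of the coordinates. *)
Definition dominance_closed (Theta : set (vec R n)) : Prop :=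
  forall mu nu, Theta mu -> dominated nu mu -> Theta nu.

Definition config_mean (blk : 'I_n -> 'I_n) (t : 'I_n -> R)
    (w : {ffun 'I_n -> option 'I_n}) : vec R n :=
  [tuple if w (blk x) == Some x then t (blk x) else 0 | x < n].

Definition spike (x : 'I_n) (t : R) : vec R n :=
  [tuple if y == x then t else 0 | y < n].

Lemma vnorm2_spike x t : vnorm2 (spike x t) = t ^+ 2.
Proof.
rewrite /vnorm2 (bigD1 x)//= big1 ?addr0 => [|y yx].
  by rewrite /Defs.coord tnth_mktuple eqxx.
by rewrite /Defs.coord tnth_mktuple (negbTE yx) expr0n.
Qed.

Lemma config_mean_place blk t (w : {ffun 'I_n -> option 'I_n}) x :
  w (blk x) = None ->
  config_mean blk t (place w (blk x) (Some x)) =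
  vadd (config_mean blk t w) (spike x (t (blk x))).
Proof.
move=> wN; apply/eq_from_tnth => y.
rewrite /config_mean /vadd /spike /Defs.coord !tnth_mktuple ffunE.
have [->|yx] := eqVneq y x; first by rewrite !eqxx wN add0r.
have [by_|_] := eqVneq (blk y) (blk x); last by rewrite addr0.
by rewrite by_ wN addr0; case: eqP => // -[xy]; rewrite xy eqxx in yx.
Qed.

(** A configuration has at most one spike in each block, so the spike of block
    [k] can be matched with the coordinate [s k] of [mu]. *)
Lemma config_mean_dominated blk t w (mu : vec R n) (s : 'I_n -> 'I_n) :
  injective s -> (forall k, `|t k| <= `|coord mu (s k)|) ->
  dominated (config_mean blk t w) mu.
Proof.
move=> sinj ts; exists (s \o blk) => [x y|x].
  rewrite !inE /Defs.coord !tnth_mktuple.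
  case: ifPn => [/eqP wx _|]; last by rewrite eqxx.
  case: ifPn => [/eqP wy _|]; last by rewrite eqxx.
  by move=> /sinj xy; move: wx; rewrite xy wy => -[].
rewrite {1 2}/Defs.coord !tnth_mktuple.
by case: ifP => [_ _|]; rewrite ?eqxx.
Qed.

(** The supremum of the risk is at least its average over the random
    configurations.  The risks of the single coordinates are finite as soon as
    the supremum is, and then the averages are computed in the reals. *)
Lemma minimax_blocks (Theta : set (vec R n)) (mu : vec R n) (s blk : 'I_n -> 'I_n)
    (t : 'I_n -> R) :
  dominance_closed Theta -> Theta mu -> injective s ->
  (forall k, `|t k| <= `|coord mu (s k)|) ->
  (forall k, block_size blk k != 0%N ->
     expR (t k ^+ 2 / sigma ^+ 2) <= expR 1 * (block_size blk k)%:R) ->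
  ((\sum_(k | block_size blk k != 0%N) (1 + expR 1)^-1 * t k ^+ 2 / 2)%:E
   <= minimax_risk sigma Theta)%E.
Proof.
move=> dom Tmu sinj ts tb; apply: le_ereal_inf_tmp => _ [delta md <-].
set M := ereal_sup _.
pose r x w : \bar R := (\int[gauss_noise sigma n]_z
  ((coord (delta (vadd (config_mean blk t w) z)) x
    - coord (config_mean blk t w) x) ^+ 2)%:E)%E.
have mdelta mu' : measurable_fun setT (fun z => delta (vadd mu' z)).
  by apply: (measurableT_comp md); exact: measurable_vadd.
have msq x mu' c : measurable_fun setT (fun z =>
    ((coord (delta (vadd mu' z)) x - c) ^+ 2)).
  apply: measurable_funX; apply: measurable_funB => //.
  exact: measurable_coord.
have r0 x w : (0 <= r x w)%E.
  by apply: integral_ge0 => z _; rewrite lee_fin sqr_ge0.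
have rM w : (\sum_x r x w <= M)%E.
  apply: ereal_sup_ubound; exists (config_mean blk t w).
    apply: dom Tmu _; exact: (config_mean_dominated _ _ sinj).
  rewrite /r -ge0_integral_sum//.
  - by apply: eq_integral => z _; rewrite sumEFin.
  - by move=> x; exact: measurable_fun_EFin.
  - by move=> x z _; rewrite lee_fin sqr_ge0.
have [->|Mfin] := eqVneq M +oo%E; first exact: leey.
have M0 : (0 <= M)%E.
  by apply: le_trans (rM [ffun=> None]); apply: sume_ge0.
have MF : M \is a fin_num by rewrite ge0_fin_numE// ltey.
have rfin x w : r x w \is a fin_num.
  rewrite ge0_fin_numE//; apply: le_lt_trans (_ : M < +oo)%E; last by rewrite ltey.
  apply: le_trans (rM w); rewrite (bigD1 x)//= leeDl//.
  exact: sume_ge0.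
rewrite -(fineK MF) lee_fin.
apply: (@bayes_blocks R n blk (fun x w => fine (r x w)) _ _ t).
- by move=> x w; exact: fine_ge0.
- move=> x w wN; rewrite -lee_fin EFinD [X in (_ <= _ + X)%E]EFinM !fineK//.
  have b0 : 0 < (block_size blk (blk x))%:R :> R by rewrite ltr0n block_size_gt0.
  have mx : measurable_fun setT (fun y : vec R n => coord (delta y) x).
    exact: measurable_coord.
  have := @two_point_test R sigma n sigma_gt0 (fun y => coord (delta y) x)
    (config_mean blk t w) (spike x (t (blk x))) 0 (t (blk x)) _ mx b0
    (vnorm2_spike _ _) (tb _ _).
  rewrite -config_mean_place// add0r /r.
  rewrite [coord (config_mean blk t w) x]/Defs.coord tnth_mktuple wN/=.
  rewrite [coord (config_mean blk t _) x]/Defs.coord tnth_mktuple ffunE !eqxx.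
  rewrite invfM mulrCA mulrA => -> //.
  by rewrite -lt0n block_size_gt0.
- move=> w; rewrite -lee_fin fineK// -sumEFin.
  by under eq_bigr do rewrite fineK//.
Qed.

End MinimaxBlocks.

Section SquareBlocks.
Variable n : nat.

Lemma square_blk_subproof (x : 'I_n) : (x * x %/ n < n)%N.
Proof.
have n0 : (0 < n)%N by apply: leq_ltn_trans (ltn_ord x).
by rewrite ltn_divLR// ltn_mul.
Qed.

(** Block [k] is made of the integers x with k n <= x^2 < (k + 1) n, about
    sqrt(n / k) / 2 of them when k is small compared with n. *)
Definition square_blk (x : 'I_n) : 'I_n := Ordinal (square_blk_subproof x).

(** With r the least integer such that k n <= r^2 and a its predecessor, the
    integers from r to a + d are in block [k] as soon as 2 a d + d^2 < n; here
    a d <= n / 3 and d^2 <= n / 9. *)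
Lemma square_block_size (k : 'I_n) d : (9 * (d * d) * k.+1 <= n)%N ->
  (d <= block_size square_blk k)%N.
Proof.
move=> dk; have n0 : (0 < n)%N by apply: leq_ltn_trans (ltn_ord k).
have kn := ltn_ord k.
have exr : exists r, (k * n <= r * r)%N.
  by exists n; rewrite leq_mul2r ltnW// orbT.
pose r := ex_minn exr.
have [rk rmin] : (k * n <= r * r)%N /\ forall q, (k * n <= q * q)%N -> (r <= q)%N.
  by rewrite /r; case: ex_minnP.
pose a := r.-1.
have ak : (a * a <= k * n)%N.
  case: (posnP r) => [r0|r0]; first by rewrite /a r0.
  rewrite leqNgt; apply/negP => /ltnW/rmin; rewrite /a; lia.
have ad : (3 * (a * d) <= n)%N.
  rewrite -leq_sqr.
  have : (9 * (a * a) * (d * d) <= n * n)%N.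
    apply: (@leq_trans (9 * (k * n) * (d * d))).
      by rewrite leq_mul2r leq_mul2l ak !orbT.
    have -> : (9 * (k * n) * (d * d) = n * (9 * (d * d) * k))%N by lia.
    by rewrite leq_mul2l (leq_trans _ dk) ?orbT// leq_mul2l leqnSn orbT.
  by congr (_ <= _)%N; lia.
have d9 : (9 * (d * d) <= n)%N.
  by apply: leq_trans dk; rewrite -[X in (X <= _)%N]muln1 leq_mul2l orbT.
have bound j : (j < d)%N -> ((r + j) * (r + j) < k.+1 * n)%N.
  move=> jd; have rj : (r + j <= a + d)%N by rewrite /a; lia.
  apply: (@leq_ltn_trans ((a + d) * (a + d))); first exact: leq_mul.
  have -> : ((a + d) * (a + d) = a * a + 2 * (a * d) + d * d)%N by lia.
  by rewrite mulSn; lia.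
have lt_n j : (j < d)%N -> (r + j < n)%N.
  move=> jd; rewrite ltnNge; apply/negP => nrj.
  have := bound j jd; rewrite ltnNge => /negP; apply.
  by apply: leq_trans (leq_mul kn (leqnn n)) _; exact: leq_mul.
pose f (j : 'I_d) : 'I_n := insubd k (r + j)%N.
have fE j : f j = (r + j)%N :> nat by rewrite /f val_insubd lt_n.
have finj : injective f.
  by move=> i j /(congr1 val) /=; rewrite !fE => /addnI/val_inj.
rewrite -[d in (d <= _)%N]card_ord -cardsT -(card_imset _ finj).
apply: subset_leq_card; apply/fintype.subsetP => _ /imsetP[j _ ->].
rewrite inE -val_eqE /= fE eqn_leq -ltnS ltn_divLR// bound//=.
rewrite leq_divRL// (leq_trans rk)//.
by rewrite leq_mul// leq_addr.
Qed.

End SquareBlocks.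

Section Levels.
Variable R : realType.

(** The squared height, in units of sigma^2, below which n / (k + 1) positions
    cannot be told apart. *)
Definition level n k : R := 1 + ln (n%:R / k.+1%:R).

Lemma ratio_ge1 n k : (k < n)%N -> 1 <= n%:R / k.+1%:R :> R.
Proof. by move=> kn; rewrite ler_pdivlMr ?ltr0n// mul1r ler_nat. Qed.

Lemma level_ge1 n k : (k < n)%N -> 1 <= level n k.
Proof. by move=> kn; rewrite lerDl ln_ge0// ratio_ge1. Qed.

Lemma level_le n i j : (i <= j)%N -> (j < n)%N -> level n j <= level n i.
Proof.
move=> ij jn; have n0 : (0 < n)%N by apply: leq_ltn_trans jn.
rewrite lerD2l ler_ln ?posrE ?divr_gt0 ?ltr0n//.
by rewrite ler_wpM2l// lef_pV2 ?posrE ?ltr0n// ler_nat.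
Qed.

Lemma ln36_le6 : ln 36 <= 6 :> R.
Proof.
have e2 : 2 <= expR 1 :> R by have := expR_ge1Dx (1 : R); lra.
rewrite -[leRHS]expRK ler_ln ?posrE ?expR_gt0//.
apply: (le_trans (y := 2 ^+ 6)); first by rewrite -natrX ler_nat.
have -> : 6 = 6%:R * 1 :> R by rewrite mulr1.
by rewrite expRM_natl; apply: lerXn2r => //; rewrite nnegrE ?expR_ge0.
Qed.

(** Take d about sqrt(n / (9 (k + 1))) in [square_block_size]: its logarithm is
    half of ln(n / (k + 1)) up to a constant, which the summand 1 absorbs. *)
Lemma level_block n (k : 'I_n) : (9 * k.+1 <= n)%N ->
  level n k / 8 <= 1 + ln (block_size (@square_blk n) k)%:R.
Proof.
move=> kn; have k0 : 0 < k.+1%:R :> R by rewrite ltr0n.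
have n0 : 0 < n%:R :> R by rewrite ltr0n; apply: leq_trans kn.
pose y : R := n%:R / (9 * k.+1%:R).
have y1 : 1 <= y.
  by rewrite ler_pdivlMr ?mulr_gt0// mul1r -natrM ler_nat.
pose d := Num.truncn (Num.sqrt y).
have sy : 1 <= Num.sqrt y by rewrite -sqrtr1 ler_sqrt// (le_trans _ y1).
have dle : d%:R <= Num.sqrt y by rewrite truncn_le// (le_trans _ sy).
have ltd : Num.sqrt y < d.+1%:R by exact: truncnS_gt.
have d1 : (1 <= d)%N.
  by rewrite lt0n; apply/eqP => dz; move: (le_lt_trans sy ltd); rewrite dz ltxx.
have dsq : d%:R ^+ 2 <= y.
  by rewrite -[leRHS]sqr_sqrtr ?lerXn2r ?nnegrE ?sqrtr_ge0// (le_trans _ y1).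
have y4 : y <= (2 * d%:R) ^+ 2.
  rewrite -[leLHS]sqr_sqrtr ?(le_trans _ y1)// lerXn2r ?nnegrE ?sqrtr_ge0 ?mulr_ge0//.
  apply/ltW/(lt_le_trans ltd); rewrite -natrM ler_nat; lia.
have db : (d <= block_size (@square_blk n) k)%N.
  apply: square_block_size; rewrite -(ler_nat R).
  move: dsq; rewrite ler_pdivlMr ?mulr_gt0// !natrM expr2.
  by congr (_ <= _); ring.
have d0 : 0 < d%:R :> R by rewrite ltr0n.
have lnd : ln d%:R <= ln (block_size (@square_blk n) k)%:R :> R.
  by rewrite ler_ln ?posrE ?ltr0n ?ler_nat// (leq_trans d1 db).
have lnd0 : 0 <= ln d%:R :> R by rewrite ln_ge0// ler1n.
have : ln (n%:R / k.+1%:R) <= ln 36 + (ln d%:R) *+ 2 :> R.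
  rewrite -lnXn// -lnM ?posrE ?exprn_gt0// ler_ln ?posrE ?divr_gt0 ?mulr_gt0 ?exprn_gt0//.
  have -> : n%:R / k.+1%:R = 9 * y by rewrite /y; field; rewrite gt_eqF.
  by apply: le_trans (_ : 9 * (2 * d%:R) ^+ 2 <= _); [rewrite ler_pM2l|rewrite le_eqVlt; apply/orP; left; apply/eqP; ring].
rewrite /level mulr2n; have := ln36_le6; lra.
Qed.

End Levels.

(** The remaining ranks are recovered by monotonicity: the terms beyond n / 9
    are at most the last one before it, and n <= 17 (n / 9) with the integer
    quotient. *)
Lemma sum_head (R : realType) (n : nat) (g : nat -> R) : (9 <= n)%N ->
  (forall i, (i < n)%N -> 0 <= g i) ->
  (forall i j, (i <= j)%N -> (j < n)%N -> g j <= g i) ->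
  \sum_(k < n) g k <= 17 * \sum_(k < n | (9 * k.+1 <= n)%N) g k.
Proof.
move=> n9 g0 gdec; pose q := (n %/ 9)%N.
have q1 : (0 < q)%N by rewrite divn_gt0.
have qn : (q <= n)%N by rewrite leq_div.
have nq : (n <= 17 * q)%N by rewrite /q; lia.
have -> : \sum_(k < n | (9 * k.+1 <= n)%N) g k = \sum_(0 <= k < q) g k.
  rewrite big_mkord (big_ord_widen_cond n xpredT)//; apply: eq_bigl => k.
  by rewrite /= leq_divRL// mulnC.
rewrite -(big_mkord xpredT g) (big_cat_nat (n := q))//=.
have head : q%:R * g q.-1 <= \sum_(0 <= k < q) g k.
  rewrite big_mkord (_ : q%:R * _ = \sum_(k < q) g q.-1); last first.
    by rewrite sumr_const card_ord mulr_natl.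
  by apply: ler_sum => k _; apply: gdec; have := ltn_ord k; lia.
have tail : \sum_(q <= k < n) g k <= (16 * q)%:R * g q.-1.
  apply: (le_trans (y := \sum_(q <= k < n) g q.-1)).
    by rewrite !big_nat; apply: ler_sum => k /andP[qk kn]; apply: gdec => //; lia.
  rewrite sumr_const_nat -[leLHS]mulr_natl ler_wpM2r//; first by apply: g0; lia.
  by rewrite ler_nat; lia.
move: tail; rewrite natrM -mulrA => tail.
have -> : 17 = 1 + 16 :> R by rewrite -natr1 addrC.
by rewrite mulrDl mul1r lerD2l (le_trans tail)// ler_wpM2l.
Qed.

Section MinimaxLower.
Variables (R : realType) (sigma : R) (n : nat).
Hypothesis sigma_gt0 : 0 < sigma.

Definition minimax_coef : R := ((1 + expR 1) * 16)^-1.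

Lemma minimax_coef_gt0 : 0 < minimax_coef.
Proof. by rewrite invr_gt0 mulr_gt0// addr_gt0// expR_gt0. Qed.

(** The [k]-th term of the energy; [s] lists the coordinates of [mu], usually
    by decreasing absolute value. *)
Definition capped (mu : vec R n) (s : 'I_n -> 'I_n) (k : 'I_n) : R :=
  Num.min (coord mu (s k) ^+ 2) (sigma ^+ 2 * level R n k).

Lemma capped_ge0 mu s k : 0 <= capped mu s k.
Proof.
rewrite le_min sqr_ge0 mulr_ge0 ?sqr_ge0//.
by apply: le_trans (level_ge1 R (ltn_ord k)).
Qed.

(** Spikes of the largest height allowed both by [mu] and by the size of the
    blocks.  Only the ranks with 9 (k + 1) <= n are used, for which the block is
    known to be nonempty. *)
Lemma minimax_lower (Theta : set (vec R n)) (mu : vec R n) (s : 'I_n -> 'I_n) :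
  dominance_closed Theta -> Theta mu -> injective s ->
  ((minimax_coef * \sum_(k < n | (9 * k.+1 <= n)%N) capped mu s k)%:E
   <= minimax_risk sigma Theta)%E.
Proof.
move=> dom Tmu sinj.
pose b k : R := (block_size (@square_blk n) k)%:R.
pose t k : R := Num.min `|coord mu (s k)| (sigma * Num.sqrt (1 + ln (b k))).
have s2 : 0 < sigma ^+ 2 by rewrite exprn_gt0.
have b1 k : block_size (@square_blk n) k != 0%N -> 1 <= b k.
  by rewrite -lt0n /b ler1n.
have t0 k : 0 <= t k by rewrite le_min normr_ge0 mulr_ge0 ?sqrtr_ge0 ?ltW.
apply: le_trans (minimax_blocks (blk := @square_blk n) (t := t) sigma_gt0 dom Tmu sinj _ _).
- rewrite lee_fin mulr_sumr [leLHS]big_mkcond [leRHS]big_mkcond/=.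
  apply: ler_sum => k _; case: ifP => [k9|_]; last first.
    by case: ifP => // _; rewrite divr_ge0// mulr_ge0 ?sqr_ge0// invr_ge0 addr_ge0// expR_ge0.
  have bk : (1 <= block_size (@square_blk n) k)%N.
    have [d1|d0] := posnP (block_size (@square_blk n) k); last by [].
    have := level_block R k9; rewrite d1 /level.
    have : (1 <= block_size (@square_blk n) k)%N by apply: square_block_size; rewrite muln1.
    by rewrite d1.
  rewrite -lt0n bk -mulrA /minimax_coef invfM -mulrA.
  apply: ler_wpM2l; first by rewrite invr_ge0 addr_ge0// expR_ge0.
  rewrite ler_pdivlMr// mulrAC (_ : 16^-1 * 2 = 8^-1); last by field.
  have lb : 0 <= 1 + ln (b k) by rewrite addr_ge0// ln_ge0// b1// -lt0n.
  have lv := level_block R k9; rewrite -/(b k) in lv.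
  have tE : t k ^+ 2 = Num.min (coord mu (s k) ^+ 2) (sigma ^+ 2 * (1 + ln (b k))).
    have e1 : coord mu (s k) ^+ 2 = `|coord mu (s k)| ^+ 2 by rewrite -normrX ger0_norm ?sqr_ge0.
    have e2 : sigma ^+ 2 * (1 + ln (b k)) = (sigma * Num.sqrt (1 + ln (b k))) ^+ 2.
      by rewrite exprMn sqr_sqrtr.
    have q0 : 0 <= sigma * Num.sqrt (1 + ln (b k)) by rewrite mulr_ge0 ?sqrtr_ge0 ?ltW.
    rewrite e1 e2 /t; case: (leP `|coord mu (s k)|) => h.
      by rewrite min_l// lerXn2r ?nnegrE ?normr_ge0.
    by rewrite min_r// lerXn2r ?nnegrE ?normr_ge0// ltW.
  rewrite tE le_min; apply/andP; split.
    apply: (le_trans (y := 8^-1 * coord mu (s k) ^+ 2)).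
      by rewrite ler_wpM2l// ge_min lexx.
    by rewrite -[leRHS]mul1r ler_wpM2r ?sqr_ge0// invf_le1 ?ler1n.
  apply: (le_trans (y := 8^-1 * (sigma ^+ 2 * level R n k))).
    by rewrite ler_wpM2l// ge_min lexx orbT.
  by rewrite mulrCA ler_pM2l// mulrC.
- by move=> k; rewrite ger0_norm// ge_min lexx.
- move=> k bk; rewrite -[block_size _ _ in leRHS]/(block_size (@square_blk n) k).
  have bk0 : 0 < b k by apply: lt_le_trans (b1 k bk).
  have lb : 0 <= 1 + ln (b k) by rewrite addr_ge0// ln_ge0// b1.
  rewrite -/(b k) -[X in _ <= _ * X](lnK (x := b k)) ?posrE// -expRD ler_expR.
  rewrite ler_pdivrMr// mulrC.
  rewrite -[X in _ <= _ * X](sqr_sqrtr lb) -exprMn lerXn2r ?nnegrE//.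
    by rewrite mulr_ge0 ?sqrtr_ge0 ?ltW.
  by rewrite ge_min lexx orbT.
Qed.

Definition decreasing_order (mu : vec R n) (s : 'I_n -> 'I_n) : Prop :=
  injective s /\
  forall i j : 'I_n, (i <= j)%N -> `|coord mu (s j)| <= `|coord mu (s i)|.

Lemma decreasing_order_exists (mu : vec R n) : exists s, decreasing_order mu s.
Proof.
pose le_abs (i j : 'I_n) := `|coord mu j| <= `|coord mu i|.
pose l := sort le_abs (enum 'I_n).
have sz : size l = n by rewrite size_sort size_enum_ord.
have lu : uniq l by rewrite sort_uniq enum_uniq.
exists (fun k => nth k l k); split=> [i j|i j ij].
  rewrite (set_nth_default j i) ?sz// => /eqP.
  by rewrite nth_uniq ?sz// => /eqP/val_inj.
have tot : total le_abs by move=> x y; exact: le_total.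
have tr : transitive le_abs by move=> y x z yx zy; exact: le_trans zy yx.
have := sorted_leq_nth tr (fun=> lexx _) i (sort_sorted tot (enum 'I_n)) => /(_ i j).
rewrite !inE -/l sz !ltn_ord => /(_ isT isT ij).
have -> : nth j l j = nth i l j by apply: set_nth_default; rewrite sz.
by [].
Qed.

Lemma minimax_energy (Theta : set (vec R n)) (mu : vec R n) s : (9 <= n)%N ->
  dominance_closed Theta -> Theta mu -> decreasing_order mu s ->
  ((minimax_coef / 17 * \sum_(k < n) capped mu s k)%:E
   <= minimax_risk sigma Theta)%E.
Proof.
move=> n9 dom Tmu [sinj sdec]; apply: le_trans (minimax_lower dom Tmu sinj).
rewrite lee_fin -mulrA ler_wpM2l ?(ltW minimax_coef_gt0)//.
rewrite ler_pdivrMl//.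
pose g i : R := if insub i is Some k then capped mu s k else 0.
have gE (k : 'I_n) : g k = capped mu s k by rewrite /g valK.
have gO i (lt_in : (i < n)%N) : g i = capped mu s (Ordinal lt_in).
  by rewrite /g insubT.
rewrite (eq_bigr (fun k : 'I_n => g k)); last by move=> k _; rewrite gE.
rewrite [X in _ <= _ * X](eq_bigr (fun k : 'I_n => g k)); last by move=> k _; rewrite gE.
apply: sum_head => // [i lt_in|i j ij lt_jn]; first by rewrite gO capped_ge0.
have lt_in := leq_ltn_trans ij lt_jn.
rewrite !gO /capped le_min !ge_min; apply/andP; split; apply/orP.
  left; rewrite -[leLHS]real_normK ?num_real// -[leRHS]real_normK ?num_real//.
  by rewrite lerXn2r ?nnegrE// sdec.
by right; rewrite ler_wpM2l ?sqr_ge0// level_le.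
Qed.

End MinimaxLower.

(** * The balls *)

Section Balls.
Variables (R : realType) (sigma : R) (n : nat).
Hypothesis sigma_gt0 : 0 < sigma.

Definition exceed (mu : vec R n) (c : R) : nat :=
  #|[set x | c < `|coord mu x|]%SET|.

Lemma dominated_exceed (nu mu : vec R n) c :
  0 <= c -> dominated nu mu -> (exceed nu c <= exceed mu c)%N.
Proof.
move=> c0 [f finj fle].
have nz x : c < `|coord nu x| -> coord nu x != 0.
  by move=> cx; rewrite -normr_gt0 (le_lt_trans c0).
have finj' : {in [set x | c < `|coord nu x|]%SET &, injective f}.
  by move=> x y; rewrite !inE => /nz xz /nz yz; apply: finj; rewrite inE.
rewrite /exceed -(card_in_imset finj'); apply: subset_leq_card.
apply/fintype.subsetP => _ /imsetP[x + ->]; rewrite !inE => cx.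
by apply: lt_le_trans cx (fle x (nz x cx)).
Qed.

Lemma l0norm_exceed (mu : vec R n) : l0norm mu = exceed mu 0.
Proof. by apply: eq_card => x; rewrite !inE normr_gt0. Qed.

Lemma sorted_nth_le (l : seq R) (c : R) i :
  sorted (fun a b => b <= a) l -> (i < size l)%N ->
  (l`_i <= c) = (count (fun a => c < a)%R l <= i)%N.
Proof.
move=> sl il.
have tr : transitive (fun a b : R => b <= a) by move=> b a d ab bd; exact: le_trans bd ab.
have mono := sorted_leq_nth tr (fun=> lexx _) 0 sl.
apply/idP/idP => [lc|].
  rewrite -(cat_take_drop i l) count_cat (_ : count _ (drop i l) = 0%N) ?addn0.
    by rewrite (leq_trans (count_size _ _))// size_take il.
  apply/eqP; rewrite -leqn0 leqNgt -has_count; apply/hasPn => a /(nthP 0)[j jl <-].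
  rewrite size_drop in jl; rewrite nth_drop -leNgt; apply: le_trans lc.
  by apply: mono; rewrite ?inE ?leq_addr//; rewrite -ltn_subRL.
rewrite leNgt; apply: contraTN => cl; rewrite -ltnNge.
apply: (@leq_trans (count (fun a => c < a)%R (take i.+1 l))); last first.
  by rewrite -{2}(cat_take_drop i.+1 l) count_cat leq_addr.
suff /eqP -> : count (fun a => c < a)%R (take i.+1 l) == size (take i.+1 l).
  by rewrite size_takel.
rewrite -all_count; apply/allP => a /(nthP 0)[j].
rewrite size_takel// => ji <-; rewrite nth_take//; apply: lt_le_trans cl _.
by apply: mono; rewrite ?inE//; lia.
Qed.

(** Weak balls constrain the number of coordinates above each threshold, a
    description that does not involve sorting. *)
Lemma abs_decreasing_le (mu : vec R n) c i : (1 <= i <= n)%N ->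
  ((abs_decreasing mu)`_i.-1 <= c) = (exceed mu c < i)%N.
Proof.
move=> /andP[i1 i_n]; rewrite /abs_decreasing sorted_nth_le.
- have /permP -> := permEl (perm_sort (fun a b : R => b <= a) [seq `|coord mu x| | x <- enum 'I_n]).
  rewrite count_map (_ : count _ _ = exceed mu c); first by rewrite -ltnS prednK.
  rewrite /exceed cardE -size_filter enumT /enum_mem; congr size.
  by apply: eq_filter => x; rewrite /= inE.
- by apply: sort_sorted => a b; exact: le_total.
- by rewrite size_sort size_map size_enum_ord; lia.
Qed.

Lemma eta_min_ge0 (p : R) : 0 <= eta_min n p.
Proof. by rewrite mulr_ge0 ?powR_ge0 ?sqrtr_ge0. Qed.

Lemma ball_dominance_closed (B : mean_ball R) :
  not_super_sparse n B -> dominance_closed (ball_set sigma n B).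
Proof.
case: B => [eta|p eta|p eta] /=.
- move=> _ mu nu mub dom; rewrite /l0_ball/=; apply: le_trans mub.
  by rewrite ler_nat !l0norm_exceed dominated_exceed.
- move=> [p0 _] mu nu mub [f finj fle]; rewrite /strong_ball/=; apply: le_trans mub.
  rewrite ler_wpM2l ?invr_ge0//.
  have pn0 : p != 0 by rewrite gt_eqF.
  pose supp := [set x | coord nu x != 0]%SET.
  have finj' : {in supp &, injective f}.
    by move=> x y; rewrite !inE => xz yz; apply: finj; rewrite inE.
  rewrite (bigID (mem supp))/= [X in _ + X]big1 ?addr0; last first.
    by move=> x; rewrite inE negbK => /eqP ->; rewrite normr0 powR0.
  apply: (le_trans (y := \sum_(x in supp) `|coord mu (f x)| `^ p)).
    apply: ler_sum => x; rewrite inE => xz.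
    by apply: ge0_ler_powR; rewrite ?nnegrE //; [exact: ltW|exact: fle].
  rewrite -(big_imset (fun y => `|coord mu y| `^ p) finj')/=.
  rewrite [leRHS](bigID (mem (f @: supp)))/= lerDl.
  by apply: sumr_ge0 => y _; exact: powR_ge0.
- move=> [p0 etap] mu nu mub dom i i1n; rewrite abs_decreasing_le//.
  have c0 : 0 <= sigma * eta * (n%:R / i%:R) `^ p^-1.
    by rewrite mulr_ge0 ?powR_ge0// mulr_ge0 ?(ltW sigma_gt0)// (le_trans (eta_min_ge0 p)).
  apply: leq_ltn_trans (dominated_exceed c0 dom) _.
  by rewrite -abs_decreasing_le//; exact: mub.
Qed.

Hypothesis n_ge9 : (9 <= n)%N.

Definition base_height : R := sigma * Num.sqrt (ln n%:R).

Lemma ln_n_ge0 : 0 <= ln (n%:R : R).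
Proof. by rewrite ln_ge0// ler1n; lia. Qed.

Lemma base_heightE : base_height ^+ 2 = sigma ^+ 2 * ln n%:R.
Proof. by rewrite exprMn sqr_sqrtr ?ln_n_ge0. Qed.

Lemma base_height_ge0 : 0 <= base_height.
Proof. by rewrite mulr_ge0 ?sqrtr_ge0 ?ltW. Qed.

Definition head_index : 'I_n := Ordinal (leq_trans (isT : (0 < 9)%N) n_ge9).

Definition flat (v : R) : vec R n := [tuple v | x < n].

(** A spike of squared height sigma^2 ln n has energy sigma^2 ln n. *)
Lemma spike_base_risk (Theta : set (vec R n)) :
  dominance_closed Theta -> Theta (spike head_index base_height) ->
  ((minimax_coef R / 17 * (sigma ^+ 2 * ln n%:R))%:E <= minimax_risk sigma Theta)%E.
Proof.
move=> dom Ts; apply: le_trans (minimax_lower sigma_gt0 dom Ts (@inj_id _)).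
rewrite lee_fin -mulrA ler_wpM2l ?(ltW (minimax_coef_gt0 _))//.
rewrite (bigD1 head_index)//=; apply: le_trans (_ : capped sigma (spike head_index base_height) id head_index <= _); last first.
  by rewrite lerDl sumr_ge0// => k _; exact: capped_ge0.
have s0 : 0 <= sigma ^+ 2 * ln (n%:R : R) by rewrite mulr_ge0 ?sqr_ge0 ?ln_n_ge0.
apply: (le_trans (y := sigma ^+ 2 * ln n%:R)).
  by rewrite ler_piMl// invf_le1 ?ler1n.
rewrite /capped /Defs.coord tnth_mktuple eqxx base_heightE le_min lexx/=.
by rewrite ler_wpM2l ?sqr_ge0// /level divr1 lerDr.
Qed.

(** For p >= 2 a spike of that height may be outside the ball; the constant
    vector with squared entries sigma^2 ln n / n has the same energy. *)
Lemma flat_base_risk (Theta : set (vec R n)) :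
  dominance_closed Theta -> Theta (flat (sigma * eta_min n 2)) ->
  ((minimax_coef R / 17 * (sigma ^+ 2 * ln n%:R))%:E <= minimax_risk sigma Theta)%E.
Proof.
move=> dom Ts; apply: le_trans (minimax_lower sigma_gt0 dom Ts (@inj_id _)).
rewrite lee_fin -mulrA ler_wpM2l ?(ltW (minimax_coef_gt0 _))//.
have n0 : 0 < n%:R :> R by rewrite ltr0n; lia.
have v2 : (sigma * eta_min n 2) ^+ 2 = sigma ^+ 2 * (ln n%:R / n%:R).
  rewrite exprMn /eta_min minxx exprMn sqr_sqrtr ?ln_n_ge0//; congr (_ * _).
  rewrite -powR_mulrn ?powR_ge0// -powRrM mulNr mulVf// powRN powRr1 ?(ltW n0)//.
  by rewrite mulrC.
have cE (k : 'I_n) : capped sigma (flat (sigma * eta_min n 2)) id k = sigma ^+ 2 * (ln n%:R / n%:R).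
  rewrite /capped /Defs.coord tnth_mktuple v2 min_l// ler_wpM2l ?sqr_ge0//.
  apply: le_trans (level_ge1 R (ltn_ord k)); rewrite ler_pdivrMr// mul1r.
  exact/ltW/ln_sublinear.
rewrite ler_pdivrMl// (eq_bigr (fun=> sigma ^+ 2 * (ln n%:R / n%:R))); last first.
  by move=> k _; rewrite cE.
apply: le_trans (sum_head (g := fun=> sigma ^+ 2 * (ln n%:R / n%:R)) n_ge9 _ _) => //.
  have -> : \sum_(k < n) sigma ^+ 2 * (ln n%:R / n%:R) = sigma ^+ 2 * ln n%:R.
    by rewrite sumr_const card_ord -[LHS]mulr_natr -mulrA divfK ?gt_eqF.
  by [].
by move=> i _; rewrite mulr_ge0 ?sqr_ge0// divr_ge0 ?ln_n_ge0.
Qed.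

Lemma ball_base_risk (B : mean_ball R) : not_super_sparse n B ->
  ((minimax_coef R / 17 * (sigma ^+ 2 * ln n%:R))%:E
   <= minimax_risk sigma (ball_set sigma n B))%E.
Proof.
move=> nss; have dom := ball_dominance_closed nss.
have n0 : 0 < n%:R :> R by rewrite ltr0n; lia.
have s0 := sigma_gt0.
have bh : `|base_height| = base_height by rewrite ger0_norm ?base_height_ge0.
have supp1 c : 0 <= c -> (exceed (spike head_index base_height) c <= 1)%N.
  move=> c0; rewrite /exceed -(cards1 head_index); apply: subset_leq_card.
  apply/fintype.subsetP => x; rewrite !inE /Defs.coord tnth_mktuple.
  by case: eqP => // _; rewrite normr0 ltNge c0.
case: B nss dom => [eta|p eta|p eta] nss dom.
- apply: spike_base_risk => //=; rewrite /l0_ball/=.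
  apply: (le_trans (y := 1)); first by rewrite l0norm_exceed lern1 supp1.
  by move: nss; rewrite /= -ler_pdivrMr// div1r.
- move: nss => /= [p0 etap].
  have pn0 : p != 0 by rewrite gt_eqF.
  have [p2|p2] := leP p 2.
    apply: spike_base_risk => //=; rewrite /strong_ball/=.
    rewrite (bigD1 head_index)//= big1 ?addr0; last first.
      move=> x xf; rewrite /Defs.coord tnth_mktuple (negbTE xf).
      by rewrite normr0 powR0.
    rewrite /Defs.coord tnth_mktuple eqxx bh /base_height.
    rewrite powRM ?(ltW s0) ?sqrtr_ge0// mulrCA ler_wpM2l ?powR_ge0//.
    apply: (le_trans (y := eta_min n p `^ p)); last first.
      apply: ge0_ler_powR => //; rewrite ?nnegrE ?eta_min_ge0 ?(ltW p0)//.
      by apply: le_trans etap; exact: eta_min_ge0.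
    rewrite /eta_min min_l// powRM ?powR_ge0 ?sqrtr_ge0//.
    by rewrite -powRrM mulNr mulVf// powRN powRr1 ?(ltW n0).
  apply: flat_base_risk => //=; rewrite /strong_ball/=.
  rewrite (eq_bigr (fun=> (sigma * eta_min n 2) `^ p)); last first.
    move=> x _; rewrite /Defs.coord tnth_mktuple ger0_norm//.
    by rewrite mulr_ge0 ?eta_min_ge0 ?(ltW s0).
  rewrite sumr_const card_ord -[X in _ * X <= _]mulr_natl mulKf ?gt_eqF//.
  rewrite powRM ?eta_min_ge0 ?(ltW s0)// ler_wpM2l ?powR_ge0//.
  have -> : eta_min n 2 = eta_min n p by rewrite /eta_min minxx min_r ?ltW.
  apply: ge0_ler_powR => //; rewrite ?nnegrE ?eta_min_ge0 ?(ltW p0)//.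
      by apply: le_trans etap; exact: eta_min_ge0.
- move: nss => /= [p0 etap].
  have pn0 : p != 0 by rewrite gt_eqF.
  have eta0 : 0 <= eta by apply: le_trans etap; exact: eta_min_ge0.
  have c0 i : 0 <= sigma * eta * (n%:R / i%:R) `^ p^-1.
    by rewrite mulr_ge0 ?powR_ge0// mulr_ge0 ?(ltW sigma_gt0).
  have [p2|p2] := leP p 2.
    apply: spike_base_risk => //= i i1n; rewrite abs_decreasing_le//.
    case: i i1n => [//|[|i]] i1n; last by rewrite ltnS (leq_trans (supp1 _ (c0 _))).
    rewrite ltnS leqn0 cards_eq0; apply/eqP/setP => x; rewrite !inE.
    apply/negbTE; rewrite -leNgt /Defs.coord tnth_mktuple.
    case: eqP => _; last by rewrite normr0 c0.
    rewrite bh divr1 /base_height -mulrA ler_wpM2l ?(ltW s0)//.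
    rewrite -ler_pdivrMr ?powR_gt0// -powRN mulrC; apply: le_trans etap.
    by rewrite /eta_min min_l.
  apply: flat_base_risk => //= i i1n; rewrite abs_decreasing_le//.
  have /andP[i1 i_n] := i1n.
  rewrite (_ : exceed _ _ = 0%N)//; apply/eqP; rewrite cards_eq0.
  apply/eqP/setP => x; rewrite !inE; apply/negbTE; rewrite -leNgt.
  rewrite /Defs.coord tnth_mktuple ger0_norm ?mulr_ge0 ?eta_min_ge0 ?(ltW s0)//.
  rewrite -mulrA ler_wpM2l ?(ltW s0)//.
  have -> : eta_min n 2 = eta_min n p by rewrite /eta_min minxx min_r ?ltW.
  apply: le_trans etap _; rewrite ler_peMr//.
  rewrite -[X in X <= _](powRr0 (n%:R / i%:R)); apply: ler_powR.
    by rewrite ler_pdivlMr ?ltr0n// mul1r ler_nat.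
  by rewrite invr_ge0 ltW.
Qed.

End Balls.

(** * Competitors *)

Lemma ffact_le_exp n h : (n ^_ h <= n ^ h)%N.
Proof.
elim: h => [|h IH]; first by rewrite ffactn0.
by rewrite ffactnSr expnSr leq_mul// leq_subr.
Qed.

(** One term of the exponential series gives h^h / h! <= e^h. *)
Lemma ln_bin_le (R : realType) n h : (0 < h <= n)%N ->
  ln ('C(n, h)%:R : R) <= h%:R * level R n h.-1.
Proof.
move=> /andP[h0 hn]; have n0 : (0 < n)%N by apply: leq_trans hn.
have hR : 0 < h%:R :> R by rewrite ltr0n.
have nR : 0 < n%:R :> R by rewrite ltr0n.
have f0 : 0 < (h`!)%:R :> R by rewrite ltr0n fact_gt0.
have stirling : h%:R ^+ h <= expR h%:R * (h`!)%:R :> R.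
  rewrite -ler_pdivrMr//; have := @expR_ge1Dxn R h%:R h.-1 (ler0n _ _).
  by rewrite prednK//; apply: le_trans; rewrite lerDr.
rewrite /level prednK// -ler_expR lnK ?posrE ?ltr0n ?bin_gt0//.
rewrite mulrDr mulr1 expRD expRM_natl lnK ?posrE ?divr_gt0//.
rewrite expr_div_n mulrA ler_pdivlMr ?exprn_gt0//.
apply: (le_trans (y := 'C(n, h)%:R * (expR h%:R * (h`!)%:R))).
  by rewrite ler_wpM2l.
rewrite mulrCA -natrM bin_ffact ler_wpM2l ?expR_ge0// -natrX ler_nat.
exact: ffact_le_exp.
Qed.

Section Competitor.
Variables (R : realType) (gamma c1 c2 : R).
Hypotheses (gamma_gt0 : 0 < gamma) (c1_gt0 : 0 < c1)
  (c2_gt0 : 0 < c2).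

Definition pen_scale : R := 2 * (1 + gamma^-1).
Definition pen_sparse : R := c1 + 1 + gamma / 2.
Definition pen_full : R := c2 + gamma / 2.
Definition competitor_coef : R :=
  (2 + pen_scale * pen_sparse) + (1 + pen_scale * pen_full) * expR (c_gamma gamma).

Lemma pen_scale_gt0 : 0 < pen_scale.
Proof. by rewrite mulr_gt0// addr_gt0// invr_gt0. Qed.

Lemma pen_sparse_gt0 : 0 < pen_sparse.
Proof. by move: gamma_gt0 c1_gt0; rewrite /pen_sparse; lra. Qed.

Lemma pen_full_gt0 : 0 < pen_full.
Proof. by move: gamma_gt0 c2_gt0; rewrite /pen_full; lra. Qed.

Lemma ln1g_le : ln (1 + gamma) <= gamma.
Proof. by apply: le_ln1Dx; move: gamma_gt0; lra. Qed.

Variables (sigma : R) (n : nat) (p : nat -> R).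
Hypotheses (sigma_gt0 : 0 < sigma) (prior : positive_prior 1 n p).
Hypothesis cond : within_prior_cond gamma c1 c2 n p.

Lemma pen_withinE h : (0 < h <= n)%N ->
  pen_within sigma gamma n p h = pen_scale * sigma ^+ 2 *
   (- ln (p h) + ln 'C(n, h)%:R + h%:R / 2 * ln (1 + gamma)).
Proof.
move=> hn; have /andP[h0 h_n] := hn.
have ph : 0 < p h by apply: prior.1.
have g1 : 0 < 1 + gamma by move: gamma_gt0; lra.
have b0 : 0 < 'C(n, h)%:R :> R by rewrite ltr0n bin_gt0.
rewrite /pen_within gtn_eqF// /pen_scale [2 * _ * sigma ^+ 2]mulrAC.
congr (_ * _); rewrite lnM ?posrE ?powR_gt0//; last by rewrite mulr_gt0 ?invr_gt0.
by rewrite lnM ?posrE ?invr_gt0// lnV ?posrE// ln_powR.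
Qed.

(** In the range where the prior is bounded below, the penalty is of the order
    of the cost h sigma^2 (1 + ln(n / h)) of a vector with h nonzero entries. *)
Lemma pen_within_sparse h :
  (0 < h <= Num.truncn (n%:R * expR (- c_gamma gamma)))%N -> (h <= n)%N ->
  pen_within sigma gamma n p h <=
    pen_scale * sigma ^+ 2 * (pen_sparse * (h%:R * level R n h.-1)).
Proof.
move=> hr hn; have /andP[h0 _] := hr; have n0 : (0 < n)%N by apply: leq_trans hn.
have [_ /(_ h hr) ph _] := cond.
have hR : 0 < h%:R :> R by rewrite ltr0n.
have nR : 0 < n%:R :> R by rewrite ltr0n.
have php : 0 < p h by apply: prior.1; rewrite h0.
rewrite pen_withinE ?h0// ler_wpM2l//.
  by rewrite mulr_ge0 ?sqr_ge0// ltW// pen_scale_gt0.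
have lnp : - ln (p h) <= c1 * (h%:R * level R n h.-1).
  rewrite lerNl; apply: (le_trans (y := ln ((h%:R / n%:R) `^ (c1 * h%:R)))); last first.
    by rewrite ler_ln ?posrE// powR_gt0// divr_gt0.
  rewrite ln_powR -invf_div lnV ?posrE ?divr_gt0// mulrN lerN2 -mulrA.
  rewrite ler_pM2l// ler_pM2l// /level prednK//; lra.
have lnb : ln 'C(n, h)%:R <= h%:R * level R n h.-1 by apply: ln_bin_le; rewrite h0.
have lv : h%:R <= h%:R * level R n h.-1.
  by rewrite -[leLHS]mulr1 ler_wpM2l ?(ltW hR)// level_ge1// prednK.
have lng : h%:R / 2 * ln (1 + gamma) <= gamma / 2 * (h%:R * level R n h.-1).
  apply: (le_trans (y := h%:R / 2 * gamma)).
    by rewrite ler_wpM2l ?ln1g_le// divr_ge0// ltW.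
  rewrite [leLHS](_ : _ = gamma / 2 * h%:R); last by field.
  by rewrite ler_wpM2l// divr_ge0// ltW.
rewrite /pen_sparse; lra.
Qed.

Lemma pen_within_full : (0 < n)%N ->
  pen_within sigma gamma n p n <= pen_scale * sigma ^+ 2 * (pen_full * n%:R).
Proof.
move=> n0; have [_ _ pn] := cond.
have pnp : 0 < p n by apply: prior.1; rewrite n0 leqnn.
rewrite pen_withinE ?n0 ?leqnn// ler_wpM2l//.
  by rewrite mulr_ge0 ?sqr_ge0// ltW// pen_scale_gt0.
have lnp : - ln (p n) <= c2 * n%:R.
  rewrite lerNl -[leLHS]expRK ler_ln ?posrE ?expR_gt0//.
have lng : n%:R / 2 * ln (1 + gamma) <= n%:R / 2 * gamma.
  by rewrite ler_wpM2l ?ln1g_le// divr_ge0.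
rewrite binn ln1 addr0 /pen_full; lra.
Qed.

Section Truncation.
Variables (mu : vec R n) (s : 'I_n -> 'I_n).
Hypothesis order : decreasing_order mu s.

Definition kept (h : nat) : {set 'I_n} := [set s k | k in [set k : 'I_n | (k < h)%N]]%SET.

(** Zeros among the kept coordinates are replaced by [sigma], so that the size
    of the support, and with it the penalty, is known exactly. *)
Definition truncation (h : nat) : vec R n :=
  [tuple if x \in kept h then (if coord mu x == 0 then sigma else coord mu x)
         else 0 | x < n].

Lemma mem_kept h k : (s k \in kept h) = (k < h)%N.
Proof. by rewrite mem_imset ?inE//; exact: order.1. Qed.

Lemma card_ord_lt h : (h <= n)%N -> #|[set k : 'I_n | (k < h)%N]%SET| = h.
Proof.
move=> hn; rewrite -sum1_card -[RHS]card_ord -[RHS]sum1_card (big_ord_widen _ (fun=> 1%N) hn).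
by apply: eq_bigl => k; rewrite inE.
Qed.

Lemma l0norm_truncation h : (h <= n)%N -> l0norm (truncation h) = h.
Proof.
move=> hn; rewrite -[RHS](card_ord_lt hn) -(card_imset _ order.1).
rewrite /l0norm; apply: eq_card => x; rewrite inE /Defs.coord tnth_mktuple -/(coord mu x) -/(kept h).
case: (x \in kept h); last by rewrite eqxx.
suff -> : (if coord mu x == 0 then sigma else coord mu x) != 0 by [].
by have [_|//] := eqVneq (coord mu x) 0; rewrite gt_eqF.
Qed.

Lemma sqdist_truncation h :
  sqdist (truncation h) mu <=
  \sum_(k < n) (if (k < h)%N then sigma ^+ 2 else coord mu (s k) ^+ 2).
Proof.
rewrite /sqdist (reindex_inj order.1)/=; apply: ler_sum => k _.
rewrite {1}/Defs.coord tnth_mktuple mem_kept -/(coord mu (s k)).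
case: ifP => _; last by rewrite sub0r sqrrN.
by case: eqP => [->|_]; rewrite ?subr0 ?subrr ?expr0n ?sqr_ge0.
Qed.

Definition energy : R := \sum_(k < n) capped sigma mu s k.

(** The last rank, counted from 1, at which the coordinate is not below its
    cap; 0 if there is none. *)
Definition cutoff : nat :=
  \max_(k < n | sigma ^+ 2 * level R n k <= coord mu (s k) ^+ 2) k.+1.

(** Up to the cutoff the coordinates and the caps are at least the cap at the
    cutoff; beyond it the coordinates are not capped. *)
Lemma energy_ge :
  cutoff%:R * (sigma ^+ 2 * level R n cutoff.-1) +
  \sum_(k < n) (if (k < cutoff)%N then 0 else coord mu (s k) ^+ 2) <= energy.
Proof.
have cn : (cutoff <= n)%N by apply/bigmax_leqP => k _; exact: ltn_ord.
have -> : cutoff%:R * (sigma ^+ 2 * level R n cutoff.-1) =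
   \sum_(k < n) (if (k < cutoff)%N then sigma ^+ 2 * level R n cutoff.-1 else 0).
  rewrite -big_mkcond/= sumr_const -[RHS]mulr_natl; congr (_%:R * _).
  by rewrite -[LHS](card_ord_lt cn); apply: eq_card => k; rewrite inE.
rewrite -big_split/=; apply: ler_sum => k _; case: ifP => kc; last first.
  rewrite add0r le_min lexx/=; apply/ltW; rewrite ltNge; apply/negP => kl.
  by move: kc; rewrite (leq_bigmax_cond (F := fun k : 'I_n => k.+1) _ kl).
rewrite addr0.
pose A := [pred k : 'I_n | sigma ^+ 2 * level R n k <= coord mu (s k) ^+ 2].
have A0 : (0 < #|A|)%N.
  rewrite lt0n; apply/eqP => A0; move: kc; rewrite /cutoff big_pred0// => i.
  exact: card0_eq A0 i.
have [k0 k0P k0E] := eq_bigmax_cond (fun k : 'I_n => k.+1) A0.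
have {}k0E : cutoff = k0.+1 by exact: k0E.
rewrite inE in k0P.
rewrite k0E/= le_min; apply/andP; split; last first.
  by rewrite ler_wpM2l ?sqr_ge0// level_le// -ltnS -k0E.
apply: le_trans k0P _.
rewrite -[leLHS]real_normK ?num_real// -[leRHS]real_normK ?num_real//.
by rewrite lerXn2r ?nnegrE// order.2// -ltnS -k0E.
Qed.

Lemma cutoff_le : (cutoff <= n)%N.
Proof. by apply/bigmax_leqP => k _; exact: ltn_ord. Qed.

Lemma energy_ge0 : 0 <= energy.
Proof. by apply: sumr_ge0 => k _; exact: capped_ge0. Qed.

Lemma sqdist_truncation_le h : (cutoff <= h <= n)%N ->
  sqdist (truncation h) mu <= h%:R * sigma ^+ 2 +
    \sum_(k < n) (if (k < cutoff)%N then 0 else coord mu (s k) ^+ 2).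
Proof.
move=> /andP[ch hn]; apply: le_trans (sqdist_truncation h) _.
have -> : h%:R * sigma ^+ 2 = \sum_(k < n) (if (k < h)%N then sigma ^+ 2 else 0).
  rewrite -big_mkcond/= sumr_const -[RHS]mulr_natl; congr (_%:R * _).
  by rewrite -[LHS](card_ord_lt hn); apply: eq_card => k; rewrite inE.
rewrite -big_split/=; apply: ler_sum => k _; case: (ltnP k h) => kh.
  by rewrite lerDl; case: ifP => // _; exact: sqr_ge0.
by rewrite add0r ltnNge (leq_trans ch kh).
Qed.

(** Keep the coordinates up to the cutoff, at least one of them.  If the cutoff
    is beyond n e^(- c(gamma)), where the prior is controlled at n only, keep all
    of them: their penalty is of order sigma^2 n, and the energy then is at
    least sigma^2 n e^(- c(gamma)). *)
Lemma competitor_exists : (9 <= n)%N -> expR (c_gamma gamma) <= n%:R ->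
  exists h, [/\ (0 < h)%N, (h <= n)%N &
    sqdist (truncation h) mu + pen_within sigma gamma n p (l0norm (truncation h))
    <= competitor_coef * (energy + sigma ^+ 2 * level R n 0)].
Proof.
move=> n9 nc; have n0 : (0 < n)%N by apply: leq_trans n9.
set T := \sum_(k < n) (if (k < cutoff)%N then 0 else coord mu (s k) ^+ 2).
have s2 : 0 < sigma ^+ 2 by rewrite exprn_gt0.
have E0 := energy_ge0.
have T0 : 0 <= T by apply: sumr_ge0 => k _; case: ifP => // _; exact: sqr_ge0.
have EC : cutoff%:R * (sigma ^+ 2 * level R n cutoff.-1) + T <= energy := energy_ge.
have a0 := pen_scale_gt0; have A10 := pen_sparse_gt0; have A20 := pen_full_gt0.
have aA1 : 0 < pen_scale * pen_sparse by exact: mulr_gt0.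
have aA2 : 0 < pen_scale * pen_full by exact: mulr_gt0.
have eC : 0 < expR (c_gamma gamma) by exact: expR_gt0.
have l0 : 1 <= level R n 0 by exact: level_ge1.
have L0 : 0 <= sigma ^+ 2 * level R n 0 by rewrite mulr_ge0 ?(ltW s2)// (le_trans _ l0).
have B0 : 0 <= (1 + pen_scale * pen_full) * expR (c_gamma gamma).
  by rewrite mulr_ge0 ?(ltW eC)// addr_ge0// ltW.
have lc : 1 <= level R n cutoff.-1.
  by apply: level_ge1; case: cutoff cutoff_le.
set x := n%:R * expR (- c_gamma gamma).
have x0 : 0 <= x by rewrite mulr_ge0 ?expR_ge0.
have [hx|hx] := leP cutoff%:R x.
  pose h := maxn cutoff 1.
  have h0 : (0 < h)%N by rewrite leq_max orbT.
  have hn : (h <= n)%N by rewrite /h geq_max cutoff_le.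
  have hr : (h <= Num.truncn x)%N.
    rewrite truncn_ge_nat// /h; case: (leqP cutoff 1) => _ //.
    by rewrite /x expRN ler_pdivlMr// mul1r.
  have hl : h%:R * (sigma ^+ 2 * level R n h.-1) + T <= energy + sigma ^+ 2 * level R n 0.
    rewrite /h; case: (posnP cutoff) => [->|cut0]; last first.
      by rewrite (maxn_idPl cut0); apply: le_trans EC _; rewrite lerDl.
    by rewrite /= mul1r addrC lerD2r; apply: le_trans EC; rewrite lerDr mulr_ge0// mulr_ge0 ?(ltW s2)// (le_trans _ lc).
  exists h; split=> //; rewrite l0norm_truncation//.
  have sq : sqdist (truncation h) mu <= h%:R * sigma ^+ 2 + T.
    by apply: sqdist_truncation_le; rewrite hn andbT leq_maxl.
  have pn : pen_within sigma gamma n p h <=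
     pen_scale * pen_sparse * (h%:R * (sigma ^+ 2 * level R n h.-1)).
    apply: le_trans (pen_within_sparse _ hn) _; first by rewrite h0.
    rewrite le_eqVlt; apply/orP; left; apply/eqP; ring.
  have hs : h%:R * sigma ^+ 2 <= h%:R * (sigma ^+ 2 * level R n h.-1).
    rewrite ler_wpM2l// -[leLHS]mulr1 ler_wpM2l ?(ltW s2)// level_ge1// prednK//.
  set Y := h%:R * (sigma ^+ 2 * _) in hl pn hs.
  have Y0 : 0 <= Y by apply: le_trans hs; rewrite mulr_ge0// ltW.
  set Z := energy + _ in hl *; rewrite /competitor_coef.
  have Z0 : 0 <= Z by rewrite addr_ge0.
  have YZ : pen_scale * pen_sparse * Y <= pen_scale * pen_sparse * Z.
    by rewrite ler_wpM2l ?(ltW aA1)//; lra.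
  have BZ : 0 <= (1 + pen_scale * pen_full) * expR (c_gamma gamma) * Z by rewrite mulr_ge0.
  rewrite mulrDl mulrDl; lra.
exists n; split=> //; rewrite l0norm_truncation//.
have sq : sqdist (truncation n) mu <= n%:R * sigma ^+ 2 + T.
  by apply: sqdist_truncation_le; rewrite cutoff_le leqnn.
have pn := pen_within_full n0.
have cs : cutoff%:R * sigma ^+ 2 <= cutoff%:R * (sigma ^+ 2 * level R n cutoff.-1).
  by rewrite ler_wpM2l// -[leLHS]mulr1 ler_wpM2l ?(ltW s2).
have ns : n%:R * sigma ^+ 2 <= expR (c_gamma gamma) * (cutoff%:R * sigma ^+ 2).
  rewrite mulrA ler_wpM2r ?(ltW s2)//.
  by move: hx; rewrite /x expRN ltr_pdivrMr// => /ltW; rewrite mulrC.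
have nE : n%:R * sigma ^+ 2 <= expR (c_gamma gamma) * energy.
  by apply: le_trans ns _; rewrite ler_wpM2l ?(ltW eC)//; lra.
have nP : pen_scale * sigma ^+ 2 * (pen_full * n%:R) <=
   pen_scale * pen_full * (expR (c_gamma gamma) * energy).
  have -> : pen_scale * sigma ^+ 2 * (pen_full * n%:R) =
    pen_scale * pen_full * (n%:R * sigma ^+ 2) by ring.
  by rewrite ler_wpM2l ?(ltW aA2).
have TE : T <= energy by apply: le_trans EC; rewrite lerDr mulr_ge0// mulr_ge0 ?(ltW s2)// (le_trans _ lc).
apply: (le_trans (y := competitor_coef * energy)); last first.
  apply: ler_wpM2l; last by rewrite lerDl.
  by rewrite /competitor_coef; apply: addr_ge0 => //; apply: addr_ge0 => //; exact: ltW.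
have aE : 0 <= pen_scale * pen_sparse * energy by rewrite mulr_ge0 ?(ltW aA1).
rewrite /competitor_coef mulrDl mulrDl -mulrA mulrDl mul1r; lra.
Qed.

End Truncation.
End Competitor.

(** * Upper bound for the risk *)

Section Assembly.
Variables (R : realType) (gamma c0 c1 c2 : R).
Hypotheses (gamma_gt0 : 0 < gamma) (c0_gt0 : 0 < c0) (c1_gt0 : 0 < c1)
  (c2_gt : c_gamma gamma < c2).

Lemma c2_gt0 : 0 < c2.
Proof. by apply: le_lt_trans c2_gt; rewrite mulr_ge0// sqr_ge0. Qed.

(** A risk that exceeds x and y exceeds their mean, whence 34 = 2 * 17 with the
    constant 17 of [minimax_energy] and [ball_base_risk]. *)
Definition base_coef : R := minimax_coef R / 34.
Definition cost_coef : R := 2 * competitor_coef gamma c1 c2 / base_coef.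

Lemma base_coef_gt0 : 0 < base_coef.
Proof. by rewrite divr_gt0// minimax_coef_gt0. Qed.

Lemma competitor_coef_gt0 : 0 < competitor_coef gamma c1 c2.
Proof.
have a0 := pen_scale_gt0 gamma_gt0; have A1 := pen_sparse_gt0 gamma_gt0 c1_gt0.
have A2 := pen_full_gt0 gamma_gt0 c2_gt0.
have h1 : 0 < pen_scale gamma * pen_sparse gamma c1 by exact: mulr_gt0.
have h2 : 0 < pen_scale gamma * pen_full gamma c2 by exact: mulr_gt0.
rewrite /competitor_coef; apply: addr_gt0; first exact: addr_gt0.
by apply: mulr_gt0; [exact: addr_gt0|exact: expR_gt0].
Qed.

Lemma cost_coef_gt0 : 0 < cost_coef.
Proof.
apply: divr_gt0; last exact: base_coef_gt0.
by apply: mulr_gt0 => //; exact: competitor_coef_gt0.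
Qed.

Lemma ln_ge1 n : (9 <= n)%N -> 1 <= ln (n%:R : R).
Proof.
move=> n9; have n0 : 0 < n%:R :> R by rewrite ltr0n (leq_trans _ n9).
rewrite -ler_expR lnK ?posrE//.
have half : expR (2^-1 : R) <= 2.
  rewrite -lef_pV2 ?posrE ?expR_gt0// -expRN.
  by apply: le_trans (expR_ge1Dx _); lra.
have -> : 1 = 2^-1 + 2^-1 :> R by field.
rewrite expRD; apply: (le_trans (y := 2 * 2)); first by rewrite ler_pM// expR_ge0.
have : 9 <= n%:R :> R by rewrite ler_nat.
by lra.
Qed.

Section Group.
Variables (sigma : R) (n : nat) (p : nat -> R).
Hypotheses (sigma_gt0 : 0 < sigma) (prior : positive_prior 1 n p)
  (cond : within_prior_cond gamma c1 c2 n p)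
  (n_ge9 : (9 <= n)%N) (n_large : expR (c_gamma gamma) <= n%:R).

Definition base_risk : R := base_coef * (sigma ^+ 2 * ln n%:R).

Definition group_cost (nu mu : vec R n) : R :=
  sqdist nu mu + pen_within sigma gamma n p (l0norm nu).

Lemma base_risk_ge : base_coef * sigma ^+ 2 <= base_risk.
Proof.
rewrite ler_wpM2l ?(ltW base_coef_gt0)//.
by rewrite -[leLHS]mulr1 ler_wpM2l ?sqr_ge0// ln_ge1.
Qed.

Lemma truncation_cost (mu : vec R n) s : decreasing_order mu s ->
  exists2 nu : vec R n, nu != vzero n &
    group_cost nu mu <=
    2 * competitor_coef gamma c1 c2 * (energy sigma mu s + sigma ^+ 2 * ln n%:R).
Proof.
move=> order.
have [h [h0 hn hle]] := competitor_exists gamma_gt0 c1_gt0 c2_gt0 sigma_gt0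
  prior cond order n_ge9 n_large.
exists (truncation sigma mu s h).
  apply/negP => /eqP z; have := l0norm_truncation sigma_gt0 order hn.
  rewrite z l0norm_exceed /exceed => hE; move: h0; rewrite -hE card_gt0 => /set0Pn[x].
  by rewrite inE /Defs.coord tnth_mktuple normr0 ltxx.
apply: le_trans hle _; rewrite -[leRHS]mulrA [leRHS]mulrCA ler_wpM2l ?(ltW competitor_coef_gt0)//.
rewrite [leRHS]mulrDr lerD//.
  by have := energy_ge0 sigma mu s; lra.
rewrite mulrCA ler_wpM2l ?sqr_ge0// /level divr1.
by have := ln_ge1 n_ge9; lra.
Qed.

(** The second component of [z] is a real lower bound of the minimax risk of the
    ball which controls both the cost of the competitor and sigma^2 ln n. *)
Lemma ball_competitor (mu : vec R n) (B : mean_ball R) :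
  not_super_sparse n B -> ball_set sigma n B mu ->
  exists z : vec R n * R, [/\ z.1 != vzero n, group_cost z.1 mu <= cost_coef * z.2,
    base_risk <= z.2 & (z.2%:E <= minimax_risk sigma (ball_set sigma n B))%E].
Proof.
move=> nss Bmu; have [s order] := decreasing_order_exists mu.
have [nu nu0 nule] := truncation_cost order.
exists (nu, base_coef * (energy sigma mu s + sigma ^+ 2 * ln n%:R)); split=> //=.
- apply: le_trans nule _; rewrite /cost_coef mulrA divfK//.
  by rewrite gt_eqF// base_coef_gt0.
- by rewrite ler_wpM2l ?(ltW base_coef_gt0)// lerDr energy_ge0.
have dom := ball_dominance_closed sigma_gt0 nss.
have e1 := minimax_energy sigma_gt0 n_ge9 dom Bmu order.
have e2 := ball_base_risk sigma_gt0 n_ge9 nss.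
have [] := leP (energy sigma mu s) (sigma ^+ 2 * ln n%:R) => h.
  apply: le_trans e2; rewrite lee_fin /base_coef.
  rewrite (_ : minimax_coef R / 17 * _ = minimax_coef R / 34 * (2 * (sigma ^+ 2 * ln n%:R))); last by field.
  rewrite ler_wpM2l ?divr_ge0 ?(ltW (minimax_coef_gt0 R))//.
  by rewrite mulr2n mulrDl mul1r lerD2r.
apply: le_trans e1; rewrite lee_fin /base_coef -/(energy sigma mu s).
rewrite (_ : minimax_coef R / 17 * _ = minimax_coef R / 34 * (2 * (energy sigma mu s))); last by field.
rewrite ler_wpM2l ?divr_ge0 ?(ltW (minimax_coef_gt0 R))//.
by rewrite mulr2n mulrDl mul1r lerD2l ltW.
Qed.

Lemma zero_competitor : exists2 nu : vec R n, nu != vzero n &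
  group_cost nu (vzero n) <= cost_coef * base_risk.
Proof.
have order : decreasing_order (vzero n : vec R n) id.
  by split=> // i j _; rewrite /Defs.coord !tnth_mktuple.
have [nu nu0 nule] := truncation_cost order; exists nu => //.
have E0 : energy sigma (vzero n) id = 0.
  rewrite /energy big1// => k _; rewrite /capped /Defs.coord tnth_mktuple expr0n/=.
  rewrite min_l// mulr_ge0 ?sqr_ge0//.
  by apply: le_trans (level_ge1 R (ltn_ord k)).
apply: le_trans nule _; rewrite E0 add0r /cost_coef /base_risk [leRHS]mulrA divfK//.
by rewrite gt_eqF// base_coef_gt0.
Qed.

End Group.

Definition between_coef : R :=
  pen_scale gamma * (c0 + 2) + pen_scale gamma * c0 * expR 1 / base_coef.

Lemma pen_between_sparse (sigma : R) m k (pi0 : nat -> R) :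
  positive_prior 0 m pi0 -> between_prior_cond c0 m pi0 ->
  (0 < k <= m)%N -> k%:R <= m%:R / expR 1 :> R ->
  pen_between sigma gamma m pi0 k <=
    pen_scale gamma * (c0 + 2) * (sigma ^+ 2 * k%:R * ln (m%:R / k%:R)).
Proof.
move=> [pos _] [low _] /andP[k0 km] kme.
have kR : 0 < k%:R :> R by rewrite ltr0n.
have mR : 0 < m%:R :> R by rewrite ltr0n (leq_trans k0).
have p0 : 0 < pi0 k by apply: pos.
have b0 : 0 < 'C(m, k)%:R :> R by rewrite ltr0n bin_gt0.
have l1 : 1 <= ln (m%:R / k%:R) :> R.
  rewrite -ler_expR lnK ?posrE ?divr_gt0// ler_pdivlMr// mulrC -ler_pdivlMr//.
rewrite /pen_between [2 * _ * _]mulrAC -/(pen_scale gamma).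
rewrite lnM ?posrE ?invr_gt0// lnV ?posrE//.
have lp : - ln (pi0 k) <= c0 * (k%:R * ln (m%:R / k%:R)).
  rewrite lerNl; apply: (le_trans (y := ln ((k%:R / m%:R) `^ (c0 * k%:R)))).
    by rewrite ln_powR -[k%:R / m%:R]invf_div lnV ?posrE ?divr_gt0// mulrN lerN2 -mulrA.
  rewrite ler_ln ?posrE ?powR_gt0 ?divr_gt0//; apply: low.
  by rewrite k0 truncn_ge_nat// divr_ge0 ?expR_ge0// ltW.
have lb : ln 'C(m, k)%:R <= k%:R * (1 + ln (m%:R / k%:R)) :> R.
  by have := @ln_bin_le R m k; rewrite k0 km /level prednK//; apply.
have lk : k%:R <= k%:R * ln (m%:R / k%:R) :> R by rewrite -[leLHS]mulr1 ler_wpM2l.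
rewrite (_ : _ * (c0 + 2) * _ = pen_scale gamma * sigma ^+ 2 *
  ((c0 + 2) * (k%:R * ln (m%:R / k%:R)))); last by ring.
rewrite ler_wpM2l//; last lra.
by rewrite mulr_ge0 ?sqr_ge0// ltW// pen_scale_gt0.
Qed.

Lemma pen_between_full (sigma : R) m (pi0 : nat -> R) :
  positive_prior 0 m pi0 -> between_prior_cond c0 m pi0 ->
  pen_between sigma gamma m pi0 m <= pen_scale gamma * c0 * (sigma ^+ 2 * m%:R).
Proof.
move=> [pos _] [_ low].
have p0 : 0 < pi0 m by apply: pos; rewrite leqnn.
rewrite /pen_between binn mulr1 lnV ?posrE// [2 * _ * _]mulrAC -/(pen_scale gamma).
rewrite (_ : _ * c0 * _ = pen_scale gamma * sigma ^+ 2 * (c0 * m%:R)); last by ring.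
rewrite ler_wpM2l//.
  by rewrite mulr_ge0 ?sqr_ge0// ltW// pen_scale_gt0.
by rewrite lerNl -[leLHS]expRK ler_ln ?posrE ?expR_gt0.
Qed.

(** The factor 2 comes from the bound of the cross term with the competitor;
    the last summand collects the additive multiples of sigma^2. *)
Definition risk_bound_coef : R :=
  (1 - split_coef gamma)^-1 *
  (2 * ((1 + expR 1) * cost_coef + between_coef)
   + (2 + (moment_coef gamma)^-1) / base_coef).

Lemma between_coef_gt0 : 0 < between_coef.
Proof.
have a0 := pen_scale_gt0 gamma_gt0.
apply: addr_gt0; first by apply: mulr_gt0 => //; exact: addr_gt0.
apply: divr_gt0; last exact: base_coef_gt0.
by apply: mulr_gt0; [exact: mulr_gt0|exact: expR_gt0].
Qed.

Lemma risk_bound_coef_gt0 : 0 < risk_bound_coef.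
Proof.
apply: mulr_gt0; first by rewrite invr_gt0 subr_gt0 split_coef_lt1.
apply: addr_gt0.
  apply: mulr_gt0 => //; apply: addr_gt0; last exact: between_coef_gt0.
  apply: mulr_gt0; last exact: cost_coef_gt0.
  by apply: addr_gt0 => //; exact: expR_gt0.
apply: divr_gt0; last exact: base_coef_gt0.
by apply: addr_gt0 => //; rewrite invr_gt0; exact: moment_coef_gt0.
Qed.

Section Risk.
Variables (m n : nat) (sigma : R) (pi0 : nat -> R) (pi : 'I_m -> nat -> R)
  (muhat : m.-tuple (vec R n) -> m.-tuple (vec R n))
  (J : {set 'I_m}) (Theta : 'I_m -> mean_ball R) (mu : m.-tuple (vec R n)).
Hypotheses (sigma_gt0 : 0 < sigma)
  (prior0 : positive_prior 0 m pi0) (prior : forall j, positive_prior 1 n (pi j))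
  (cond0 : between_prior_cond c0 m pi0)
  (cond : forall j, within_prior_cond gamma c1 c2 n (pi j))
  (estim : map_estimator sigma gamma pi0 pi muhat)
  (J_neq0 : J != finset.set0)
  (nss : forall j, j \in J -> not_super_sparse n (Theta j))
  (mu_in : group_parameters sigma J Theta mu)
  (n_ge9 : (9 <= n)%N) (n_large : expR (c_gamma gamma) <= n%:R).

Local Notation base := (base_risk sigma n).

Lemma competitors_exist : exists f : 'I_m -> vec R n * R, forall j,
  [/\ (f j).1 != vzero n,
      group_cost sigma (pi j) (f j).1 (tnth mu j) <= cost_coef * (f j).2,
      base <= (f j).2,
      j \in J -> ((f j).2%:E <= minimax_risk sigma (ball_set sigma n (Theta j)))%E
    & j \notin J -> (f j).2 = base].
Proof.
pose P j (z : vec R n * R) := [/\ z.1 != vzero n,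
  group_cost sigma (pi j) z.1 (tnth mu j) <= cost_coef * z.2, base <= z.2,
  j \in J -> (z.2%:E <= minimax_risk sigma (ball_set sigma n (Theta j)))%E
  & j \notin J -> z.2 = base].
suff ex j : exists z : vec R n * R, P j z by have [f fP] := boolp.choice ex; exists f.
rewrite /P; have := mu_in j; case: ifPn => [jJ muj|jJ ->].
  have [z [z0 zc zb zr]] :=
    ball_competitor sigma_gt0 (prior j) (cond j) n_ge9 n_large (nss jJ) muj.
  by exists z; split=> //; rewrite jJ.
have [nu nu0 nuc] := zero_competitor sigma_gt0 (prior j) (cond j) n_ge9 n_large.
by exists (nu, base); split=> //; rewrite (negbTE jJ).
Qed.

(** The oracle inequality with the competitors of the groups of J if J is
    small, and with nonzero competitors in all m groups otherwise; in the second
    case m <= e |J|, so the groups outside J cost no more than those in J, up to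
    the factor e. *)
Lemma group_risk_bound :
  (group_risk sigma muhat mu <= risk_bound_coef%:E * maxe
     (\sum_(j in J) minimax_risk sigma (ball_set sigma n (Theta j)))
     (sigma ^+ 2 * #|J|%:R * ln (m%:R / #|J|%:R))%:E)%E.
Proof.
have [f fP] := competitors_exist.
pose k := #|J|; pose V := \sum_(j in J) (f j).2.
pose W := sigma ^+ 2 * k%:R * ln (m%:R / k%:R).
have k0 : (0 < k)%N by rewrite card_gt0.
have km : (k <= m)%N by rewrite -[m in (_ <= m)%N]card_ord max_card.
have kR : 0 < k%:R :> R by rewrite ltr0n.
have mR : 0 < m%:R :> R by rewrite ltr0n (leq_trans k0).
have s2 : 0 < sigma ^+ 2 by rewrite exprn_gt0.
have b0 := base_coef_gt0; have e0 := expR_gt0 (1 : R).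
have D0 := cost_coef_gt0; have a0 := pen_scale_gt0 gamma_gt0.
have base_ge := base_risk_ge sigma n_ge9.
have base_gt0 : 0 < base by apply: lt_le_trans base_ge; exact: mulr_gt0.
have f0 j : 0 <= (f j).2 by have [_ _ + _ _] := fP j; apply: le_trans; exact: ltW.
have kbase : k%:R * base <= V.
  rewrite mulr_natl -sumr_const; apply: ler_sum => j _.
  by have [] := fP j.
have ksigma : sigma ^+ 2 * k%:R <= V / base_coef.
  rewrite ler_pdivlMr//; apply: le_trans kbase.
  by rewrite mulrC mulrA mulrC ler_pM2l.
have V_le : (V%:E <= \sum_(j in J) minimax_risk sigma (ball_set sigma n (Theta j)))%E.
  rewrite -sumEFin; apply: lee_sum => j jJ.
  by have [_ _ _ /(_ jJ) + _] := fP j.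
(* [pi0] is bounded below at |J| if |J| <= m / e, and always at m *)
pose sparse := (k <= Num.truncn (m%:R / expR 1 : R))%N.
pose T : {set 'I_m} := if sparse then J else [set: 'I_m]%SET.
pose nu : m.-tuple (vec R n) :=
  [tuple if j \in T then (f j).1 else vzero n | j < m].
have outT j : j \notin T -> tnth mu j = vzero n.
  move=> jT; have := mu_in j; rewrite ifN//; apply: contra jT.
  by rewrite /T; case: ifP; rewrite ?inE.
have activeE : [set j | tnth nu j != vzero n]%SET = T.
  apply/setP => j; rewrite !inE tnth_mktuple.
  by case: ifP => _; rewrite ?eqxx//; have [-> ] := fP j.
have costs : \sum_j group_cost sigma (pi j) (tnth nu j) (tnth mu j)
    <= cost_coef * \sum_(j in T) (f j).2.
  rewrite mulr_sumr [leRHS]big_mkcond/=; apply: ler_sum => j _.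
  rewrite tnth_mktuple; case: ifP => jT; first by have [] := fP j.
  rewrite outT ?jT// /group_cost /sqdist big1 => [|i _]; last by rewrite subrr expr0n.
  rewrite add0r /pen_within (_ : l0norm _ = 0%N)//.
  apply/eqP; rewrite cards_eq0; apply/eqP/setP => i.
  by rewrite !inE /Defs.coord tnth_mktuple eqxx.
have mk : ~~ sparse -> m%:R <= expR 1 * k%:R :> R.
  rewrite /sparse truncn_ge_nat; last by rewrite divr_ge0 ?ltW.
  by rewrite -ltNge ltr_pdivrMr// => /ltW; rewrite mulrC.
have V0 : 0 <= V by apply: sumr_ge0.
have sumT : \sum_(j in T) (f j).2 <= (1 + expR 1) * V.
  rewrite /T; case: ifPn => sp.
    by rewrite mulrDl mul1r lerDl mulr_ge0// ltW.
  rewrite (eq_bigl xpredT); last by move=> j; rewrite inE.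
  rewrite (bigID (mem J))/= -/V mulrDl mul1r lerD2l.
  rewrite (eq_bigr (fun=> base)); last by move=> j jJ; have [_ _ _ _ ->] := fP j.
  apply: (le_trans (y := m%:R * base)).
    rewrite sumr_const -[leLHS]mulr_natl ler_wpM2r ?(ltW base_gt0)// ler_nat.
    by rewrite -[m in (_ <= m)%N]card_ord max_card.
  apply: (le_trans (y := expR 1 * k%:R * base)).
    by rewrite ler_wpM2r ?(ltW base_gt0)// mk.
  by rewrite -mulrA ler_wpM2l// ltW.
pose X := Num.max V W.
have VX : V <= X by rewrite le_max lexx.
have WX : W <= X by rewrite le_max lexx orbT.
have X0 : 0 <= X by apply: le_trans VX.
have penT : pen_between sigma gamma m pi0 #|T| <= between_coef * X.
  have h1 : 0 <= pen_scale gamma * (c0 + 2) by rewrite mulr_ge0 ?(ltW a0)// addr_ge0// ltW.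
  have h2 : 0 <= pen_scale gamma * c0 * expR 1 / base_coef.
    by apply: divr_ge0 (ltW b0); apply: mulr_ge0 (ltW e0); apply: mulr_ge0; exact: ltW.
  rewrite /between_coef mulrDl /T; case: ifPn => sp.
    apply: (le_trans (y := pen_scale gamma * (c0 + 2) * X)).
      apply: (le_trans (y := pen_scale gamma * (c0 + 2) * W)); last by rewrite ler_wpM2l.
      apply: pen_between_sparse => //; first by rewrite k0 km.
      by rewrite -truncn_ge_nat// divr_ge0// ltW.
    by rewrite lerDl mulr_ge0.
  apply: (le_trans (y := pen_scale gamma * c0 * expR 1 / base_coef * X)); last first.
    by rewrite lerDr mulr_ge0.
  rewrite cardsT card_ord; apply: le_trans (pen_between_full _ prior0 cond0) _.
  have h3 : sigma ^+ 2 * m%:R <= expR 1 * (V / base_coef).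
    apply: (le_trans (y := expR 1 * (sigma ^+ 2 * k%:R))); last by rewrite ler_pM2l.
    by rewrite mulrCA ler_pM2l// mk.
  have h4 : V / base_coef <= X / base_coef by rewrite ler_pM2r ?invr_gt0.
  rewrite (_ : _ / base_coef * X = pen_scale gamma * c0 * (expR 1 * (X / base_coef))); last by ring.
  rewrite ler_wpM2l//; first by apply: mulr_ge0; exact: ltW.
  by apply: le_trans h3 _; rewrite ler_pM2l.
have noise : 2 * sigma ^+ 2 + sigma ^+ 2 / moment_coef gamma
    <= (2 + (moment_coef gamma)^-1) / base_coef * X.
  have nc : 0 < (moment_coef gamma)^-1 by rewrite invr_gt0; exact: moment_coef_gt0.
  rewrite [sigma ^+ 2 / _]mulrC -mulrDl -mulrA ler_pM2l; last exact: addr_gt0.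
  apply: (le_trans (y := V / base_coef)).
    apply: le_trans ksigma; rewrite -[leLHS]mulr1 ler_pM2l// ler1n.
    exact: k0.
  by rewrite mulrC ler_pM2l ?invr_gt0.
have PH j : assumption_P gamma n (pi j) by have [] := cond j.
have total : 2 * gdist nu mu + total_penalty gamma sigma pi0 pi nu <=
    2 * (((1 + expR 1) * cost_coef + between_coef) * X).
  have pen0 := total_penalty_ge0 gamma_gt0 sigma prior0 prior PH nu.
  apply: (le_trans (y := 2 * (gdist nu mu + total_penalty gamma sigma pi0 pi nu))).
    by move: pen0; lra.
  rewrite ler_pM2l// /total_penalty activeE addrA -big_split/= mulrDl lerD//.
  apply: le_trans costs _; rewrite [X in _ <= X * _]mulrC -[leRHS]mulrA ler_pM2l//.
  by apply: le_trans sumT _; rewrite ler_wpM2l// addr_ge0// ltW.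
apply: le_trans (oracle_inequality gamma_gt0 sigma_gt0 prior0 prior
  PH mu nu estim) _.
apply: (le_trans (y := (risk_bound_coef * X)%:E)).
  rewrite lee_fin /risk_bound_coef -[leRHS]mulrA; apply: ler_wpM2l.
    by rewrite invr_ge0 subr_ge0 ltW// split_coef_lt1.
  rewrite [leRHS]mulrDl -[leLHS]addrA; apply: lerD => //.
  by rewrite -[leRHS]mulrA.
rewrite EFinM; apply: lee_wpmul2l; first by rewrite lee_fin ltW// risk_bound_coef_gt0.
rewrite /X EFin_max ge_max !le_max V_le/=.
by rewrite lexx orbT.
Qed.

End Risk.
End Assembly.

Theorem theorem2 (R : realType) (gamma c0 c1 c2 : R)
    (gamma_gt0 : 0 < gamma) (c0_gt0 : 0 < c0) (c1_gt0 : 0 < c1)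
    (c2_gt : c_gamma gamma < c2) :
  exists2 C1 : R, 0 < C1 & exists N : nat,
  forall (m n : nat), (N <= m)%N -> (N <= n)%N ->
  forall (sigma : R) (pi0 : nat -> R) (pi : 'I_m -> nat -> R)
    (muhat : m.-tuple (vec R n) -> m.-tuple (vec R n))
    (J : {set 'I_m}) (Theta : 'I_m -> mean_ball R),
  0 < sigma ->
  positive_prior 0 m pi0 ->
  (forall j, positive_prior 1 n (pi j)) ->
  between_prior_cond c0 m pi0 ->
  (forall j, within_prior_cond gamma c1 c2 n (pi j)) ->
  map_estimator sigma gamma pi0 pi muhat ->
  J != finset.set0 ->
  (forall j, j \in J -> not_super_sparse n (Theta j)) ->
  (ereal_sup [set group_risk sigma muhat mu
               | mu in group_parameters sigma J Theta]
   <= C1%:E * maxe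
     (\sum_(j in J) minimax_risk sigma (ball_set sigma n (Theta j)))
     (sigma ^+ 2 * #|J|%:R * ln (m%:R / #|J|%:R))%:E)%E.
Proof.
exists (risk_bound_coef gamma c0 c1 c2); first exact: risk_bound_coef_gt0.
(* n >= 9 makes block 0 nonempty and ln n >= 1; n >= e^c(gamma) puts h = 1 in
   the range where the priors [pi j] are bounded below. *)
exists (maxn 9 (Num.truncn (expR (c_gamma gamma))).+1) => m n _.
rewrite geq_max => /andP[n9 nc] sigma pi0 pi muhat J Theta s0 pr0 pr cd0 cd est J0 nss.
apply: ge_ereal_sup => _ [mu mu_in <-].
apply: (group_risk_bound gamma_gt0 c0_gt0 c1_gt0 c2_gt s0 pr0 pr cd0 cd est J0 nss mu_in n9).
by apply/ltW/(lt_le_trans (truncnS_gt _)); rewrite ler_nat.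
Qed.
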